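(* Let $k$ be a field and let $\Lambda=kQ/I$ be an admissible quotient of the path algebra $kQ$. Suppose that there are arrows $a_i\colon v_{e_i}\to v_{f_i}$ in $Q$ for $i=1,2,\dots,t$ which do not occur in a set of minimal generators of $I$ in $kQ$ and that $\operatorname{Hom}_\Lambda(e_i\Lambda,f_j\Lambda)=0$ for all $i$ and $j$ in $\{1,2,\dots,t\}$. Let $\overline a_i=a_i+I$ and $\Gamma=\Lambda/\Lambda\{\overline a_i\}_{i=1}^t\Lambda$. Then: (i) $f_j\Gamma e_i\simeq\operatorname{Hom}_\Gamma(e_i\Gamma,f_j\Gamma)=0$ for all $i$ and $j$ in $\{1,2,\dots,t\}$. (ii) $\sum_{i=1}^t\Lambda\overline a_i\Lambda\simeq\bigoplus_{i=1}^t\Lambda\overline a_i\Lambda$ and $\Lambda\overline a_i\Lambda\simeq\Gamma e_i\otimes_kf_i\Gamma$ as $\Gamma$-$\Gamma$-bimodules. In particular, $\sum_{i=1}^t\Lambda\overline a_i\Lambda$ is a projective $\Gamma$-$\Gamma$-bimodule. (iii) $\Lambda$ is isomorphic to the trivial extension $\Gamma\ltimes P$, where $P=\bigoplus_{i=1}^t\Gamma e_i\otimes_kf_i\Gamma$ with $\operatorname{Hom}_\Gamma(e_i\Gamma,f_j\Gamma)=0$ for all $i$ and $j$ in $\{1,2,\dots,t\}$.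
   Context: Admissible quotient means: $Q$ is a finite quiver and $I$ is a two-sided ideal of $kQ$ with $J^m\subseteq I\subseteq J^2$ for some $m\ge2$, where $J$ is the ideal generated by the arrows. Paths are composed from left to right; for a trivial path (primitive idempotent) $e$ the corresponding vertex is $v_e$, and an arrow $a\colon v_e\to v_f$ satisfies $a=eaf$. The same symbols denote the images of trivial paths in quotient algebras. ''The arrows $a_1,\dots,a_t$ do not occur in a set of minimal generators of $I$'' means that there is a minimal generating set of the two-sided ideal $I$ such that none of the $a_i$ occurs in any path appearing (with non-zero coefficient) in any element of that set. Modules are right modules. $\Lambda\{\overline a_i\}_{i=1}^t\Lambda$ is the two-sided ideal generated by the $\overline a_i$. Let $Q^*$ be $Q$ with the arrows $a_1,\dots,a_t$ removed. Then $\Gamma\simeq kQ^*/(I\cap kQ^* )$ via the map induced by $kQ^*\subseteq kQ$, and the inclusion $kQ^*\to kQ$ induces an injective algebra homomorphism $\nu\colon\Gamma\to\Lambda$ with $\pi\nu=\mathrm{id}_\Gamma$, where $\pi\colon\Lambda\to\Gamma$ is the canonical surjection; ideals of $\Lambda$ are regarded as $\Gamma$-$\Gamma$-bimodules via $\nu$. For a $\Gamma$-$\Gamma$-bimodule $P$, the trivial extension $\Gamma\ltimes P$ is $\Gamma\oplus P$ with multiplication $(\gamma,p)(\gamma',p')=(\gamma\gamma',\gamma p'+p\gamma')$. *)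

(* Defs.v *)
From HB Require Import structures.
From mathcomp Require Import all_boot all_algebra.
From mathcomp Require Import generic_quotient ring_quotient.
From mathcomp Require Import finmap boolp functions.
From mathcomp Require Import monalg.

Set Implicit Arguments.
Unset Strict Implicit.
Unset Printing Implicit Defensive.

Import GRing.Theory.
Local Open Scope ring_scope.
Local Open Scope quotient_scope.

(* Unital associative algebras over k, the zero algebra included: MathComp's
   algType requires 1 != 0, which a quotient by an arbitrary ideal need not
   satisfy.  The join of lmodType and pzRingType is closed in the hierarchy, so
   the scaling is a field of the mixin and the Lmodule structure derives
   from it. *)
HB.mixin Record isPzAlgebra (k : pzRingType) A of GRing.PzRing A := {
  pzscale : k -> A -> A;
  pzscaleA : forall c d x, pzscale c (pzscale d x) = pzscale (c * d) x;
  pzscale1r : left_id 1 pzscale;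
  pzscaleDr : right_distributive pzscale +%R;
  pzscaleDl : forall x, {morph pzscale^~ x : c d / c + d};
  pzscaleAl : forall c x y, pzscale c (x * y) = pzscale c x * y;
  pzscaleAr : forall c x y, pzscale c (x * y) = x * pzscale c y
}.
#[short(type="pzAlgType")]
HB.structure Definition PzAlgebra (k : pzRingType) :=
  { A of GRing.PzRing A & isPzAlgebra k A }.

HB.instance Definition _ (k : pzRingType) (A : pzAlgType k) :=
  GRing.Zmodule_isLmodule.Build k (PzAlgebra.sort A)
    (@pzscaleA k A) (@pzscale1r k A) (@pzscaleDr k A) (@pzscaleDl k A).

Lemma pzscalerAl (k : pzRingType) (A : pzAlgType k) (c : k) (x y : A) :
  c *: (x * y) = (c *: x) * y.
Proof. exact: pzscaleAl. Qed.

Lemma pzscalerAr (k : pzRingType) (A : pzAlgType k) (c : k) (x y : A) :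
  c *: (x * y) = x * (c *: y).
Proof. exact: pzscaleAr. Qed.

Record algHom (k : pzRingType) (A B : pzAlgType k) := AlgHom {
  algHom_rmorphism :> {rmorphism A -> B};
  algHomZ : scalable algHom_rmorphism
}.

Definition alg_iso (k : pzRingType) (A B : pzAlgType k) : Prop :=
  exists f : algHom A B, bijective f.

Definition lmod_iso (k : pzRingType) (V W : lmodType k) : Prop :=
  exists f : {linear V -> W}, bijective f.

Record submodule (k : pzRingType) (V : lmodType k) := Submodule {
  submodule_mem :> V -> Prop;
  submodule0 : submodule_mem 0;
  submoduleD : forall x y,
    submodule_mem x -> submodule_mem y -> submodule_mem (x + y);
  submoduleZ : forall c x, submodule_mem x -> submodule_mem (c *: x)
}.

Record ideal (k : pzRingType) (A : pzAlgType k) := Ideal {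
  ideal_mem :> A -> Prop;
  ideal0 : ideal_mem 0;
  idealD : forall x y, ideal_mem x -> ideal_mem y -> ideal_mem (x + y);
  idealMl : forall x y, ideal_mem y -> ideal_mem (x * y);
  idealMr : forall x y, ideal_mem x -> ideal_mem (x * y)
}.

Section Submodule.
Variables (k : pzRingType) (V : lmodType k).
Implicit Types S : submodule V.

Definition submodule_pred S : {pred V} := fun x => `[< S x >].

Lemma submodule_predP S x : reflect (S x) (x \in submodule_pred S).
Proof. exact: asboolP. Qed.

Fact submodule_pred_closed S : submod_closed (submodule_pred S).
Proof.
split=> [|c x y /submodule_predP Sx /submodule_predP Sy].
  exact/submodule_predP/submodule0.
by apply/submodule_predP/submoduleD => //; apply: submoduleZ.
Qed.

HB.instance Definition _ S :=
  GRing.isSubmodClosed.Build k V (submodule_pred S) (submodule_pred_closed S).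

Definition submodule_type S := {x : V | submodule_pred S x}.
HB.instance Definition _ S := SubChoice.on (submodule_type S).
HB.instance Definition _ S :=
  [SubChoice_isSubLmodule of submodule_type S by <:].

Definition span (X : V -> Prop) : submodule V.
Proof.
exists (fun x => forall S, (forall y, X y -> S y) -> S x)
  => [S _|x y Hx Hy S XS|c x Hx S XS].
- exact: submodule0.
- by apply: submoduleD; [apply: Hx | apply: Hy].
- by apply: submoduleZ; apply: Hx.
Defined.

Lemma span_gen (X : V -> Prop) x : X x -> span X x.
Proof. by move=> Xx S; apply. Qed.

Lemma span_min (X : V -> Prop) S :
  (forall y, X y -> S y) -> forall x, span X x -> S x.
Proof. by move=> XS x; apply. Qed.

Definition lquot S : Type := @Quotient.quot V (submodule_pred S).
HB.instance Definition _ S := GRing.Zmodule.on (lquot S).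

Definition cls S (x : V) : lquot S := \pi_(@Quotient.quot V (submodule_pred S)) x.

Lemma cls_eq S x y : cls S x = cls S y <-> S (x - y).
Proof.
split=> [/eqP|Sxy]; first by rewrite /cls -Quotient.idealrBE => /submodule_predP.
by apply/eqP; rewrite /cls -Quotient.idealrBE; apply/submodule_predP.
Qed.

Fact cls_zmod S : zmod_morphism (cls S).
Proof. by move=> x y; rewrite /cls !raddfB. Qed.
HB.instance Definition _ S :=
  GRing.isZmodMorphism.Build V (lquot S) (cls S) (cls_zmod S).

Lemma cls_eq0 S x : cls S x = 0 <-> S x.
Proof. by rewrite -(raddf0 (cls S)) cls_eq subr0. Qed.

Lemma cls_surj S (q : lquot S) : exists x, q = cls S x.
Proof. by exists (repr q); rewrite /cls reprK. Qed.

Definition lquot_scale S (c : k) (q : lquot S) : lquot S := cls S (c *: repr q).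

Fact cls_scale S c x : lquot_scale c (cls S x) = cls S (c *: x).
Proof.
apply/cls_eq; rewrite -scalerBr; apply: submoduleZ; apply/cls_eq.
by rewrite {1}/cls reprK.
Qed.

Fact lquot_scaleA S c d (q : lquot S) :
  lquot_scale c (lquot_scale d q) = lquot_scale (c * d) q.
Proof. by have [x ->] := cls_surj q; rewrite !cls_scale scalerA. Qed.
Fact lquot_scale1 S : left_id 1 (@lquot_scale S).
Proof. by move=> q; have [x ->] := cls_surj q; rewrite cls_scale scale1r. Qed.
Fact lquot_scaleDr S : right_distributive (@lquot_scale S) +%R.
Proof.
move=> c p q; have [x ->] := cls_surj p; have [y ->] := cls_surj q.
by rewrite -raddfD !cls_scale scalerDr raddfD.
Qed.
Fact lquot_scaleDl S (q : lquot S) :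
  {morph (@lquot_scale S)^~ q : c d / c + d}.
Proof.
by move=> c d; have [x ->] := cls_surj q; rewrite !cls_scale scalerDl raddfD.
Qed.
HB.instance Definition _ S := GRing.Zmodule_isLmodule.Build k (lquot S)
  (@lquot_scaleA S) (@lquot_scale1 S) (@lquot_scaleDr S) (@lquot_scaleDl S).

Fact cls_is_scalable S : scalable (cls S).
Proof. by move=> c x; rewrite -cls_scale. Qed.
HB.instance Definition _ S :=
  GRing.isScalable.Build k V (lquot S) *:%R (cls S) (cls_is_scalable S).

Definition lquot_lift S (W : Type) (f : V -> W) (q : lquot S) : W := f (repr q).

Lemma lquot_liftE S (W : lmodType k) (f : {linear V -> W}) :
  (forall x, S x -> f x = 0) -> forall x, lquot_lift f (cls S x) = f x.
Proof.
move=> fS x; apply/eqP; rewrite /lquot_lift -subr_eq0 -raddfB; apply/eqP/fS.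
by apply/cls_eq; rewrite {1}/cls reprK.
Qed.

End Submodule.

Section Ideal.
Variables (k : pzRingType) (A : pzAlgType k).
Implicit Types I K : ideal A.

Fact ideal_scale I c x : I x -> I (c *: x).
Proof. by move=> Ix; rewrite -[x]mul1r pzscalerAl; apply: idealMl. Qed.

Definition submodule_of_ideal I : submodule A :=
  Submodule (@ideal0 _ _ I) (@idealD _ _ I) (@ideal_scale I).

Coercion submodule_of_ideal : ideal >-> submodule.

Definition ideal_gen (X : A -> Prop) : ideal A.
Proof.
exists (fun x => forall I, (forall y, X y -> I y) -> I x)
  => [I _|x y Hx Hy I XI|x y Hy I XI|x y Hx I XI].
- exact: ideal0.
- by apply: idealD; [apply: Hx | apply: Hy].
- by apply: idealMl; apply: Hy.
- by apply: idealMr; apply: Hx.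
Defined.

Lemma ideal_gen_sub (X : A -> Prop) x : X x -> ideal_gen X x.
Proof. by move=> Xx I; apply. Qed.

Definition ideal1 : ideal A.
Proof. by exists (fun=> True). Defined.

Definition ideal_prod I K : ideal A :=
  ideal_gen (fun z => exists x y, [/\ I x, K y & z = x * y]).

Fixpoint ideal_exp I m : ideal A :=
  if m is m'.+1 then ideal_prod (ideal_exp I m') I else ideal1.

Definition ideal_principal (x : A) : ideal A := ideal_gen (eq x).

Definition ideal_sum t (K : 'I_t -> ideal A) : ideal A.
Proof.
exists (fun x => exists2 y : 'I_t -> A, forall i, K i (y i) & x = \sum_i y i).
- by exists (fun=> 0) => [i|]; [apply: ideal0 | rewrite big1].
- move=> x y [x' Hx ->] [y' Hy ->]; exists (fun i => x' i + y' i).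
    by move=> i; apply: idealD.
  by rewrite big_split.
- move=> x y [y' Hy ->]; exists (fun i => x * y' i).
    by move=> i; apply: idealMl.
  by rewrite mulr_sumr.
- move=> x y [x' Hx ->]; exists (fun i => x' i * y).
    by move=> i; apply: idealMr.
  by rewrite mulr_suml.
Defined.

Definition algQuot I : Type := lquot I.
HB.instance Definition _ I := GRing.Lmodule.on (algQuot I).

Definition aq_mul I (p q : algQuot I) : algQuot I := cls I (repr p * repr q).

Fact cls_mul I x y : aq_mul (cls I x) (cls I y) = cls I (x * y).
Proof.
apply/cls_eq => /=.
have E z : I (repr (cls I z) - z) by apply/(cls_eq I); rewrite {1}/cls reprK.
rewrite -[_ - _](subrKA (x * repr (cls I y))) -mulrBl -mulrBr.
by apply: idealD; [apply: idealMr | apply: idealMl].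
Qed.

Fact aq_mulA I : associative (@aq_mul I).
Proof.
move=> p q r; have [x ->] := cls_surj p; have [y ->] := cls_surj q.
by have [z ->] := cls_surj r; rewrite !cls_mul mulrA.
Qed.
Fact aq_mul1r I : left_id (cls I 1 : algQuot I) (@aq_mul I).
Proof. by move=> q; have [x ->] := cls_surj q; rewrite cls_mul mul1r. Qed.
Fact aq_mulr1 I : right_id (cls I 1 : algQuot I) (@aq_mul I).
Proof. by move=> q; have [x ->] := cls_surj q; rewrite cls_mul mulr1. Qed.
Fact aq_mulDl I : left_distributive (@aq_mul I) +%R.
Proof.
move=> p q r; have [x ->] := cls_surj p; have [y ->] := cls_surj q.
by have [z ->] := cls_surj r; rewrite -raddfD !cls_mul mulrDl raddfD.
Qed.
Fact aq_mulDr I : right_distributive (@aq_mul I) +%R.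
Proof.
move=> p q r; have [x ->] := cls_surj p; have [y ->] := cls_surj q.
by have [z ->] := cls_surj r; rewrite -raddfD !cls_mul mulrDr raddfD.
Qed.
HB.instance Definition _ I := GRing.Zmodule_isPzRing.Build (algQuot I)
  (@aq_mulA I) (@aq_mul1r I) (@aq_mulr1 I) (@aq_mulDl I) (@aq_mulDr I).

Fact aq_scaleAl I (c : k) (p q : algQuot I) : c *: (p * q) = (c *: p) * q.
Proof.
have [x ->] := cls_surj p; have [y ->] := cls_surj q.
by rewrite /GRing.mul /= cls_mul /GRing.scale /= !cls_scale cls_mul pzscalerAl.
Qed.
Fact aq_scaleAr I (c : k) (p q : algQuot I) : c *: (p * q) = p * (c *: q).
Proof.
have [x ->] := cls_surj p; have [y ->] := cls_surj q.
by rewrite /GRing.mul /= cls_mul /GRing.scale /= !cls_scale cls_mul pzscalerAr.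
Qed.
HB.instance Definition _ I := isPzAlgebra.Build k (algQuot I)
  (@lquot_scaleA _ _ I) (@lquot_scale1 _ _ I) (@lquot_scaleDr _ _ I)
  (@lquot_scaleDl _ _ I) (@aq_scaleAl I) (@aq_scaleAr I).

Definition aproj I (x : A) : algQuot I := cls I x.
HB.instance Definition _ I := GRing.Linear.copy (aproj I) (cls I).
Fact aproj_monoid I : monoid_morphism (aproj I).
Proof. by split=> // x y; rewrite /aproj -cls_mul. Qed.
HB.instance Definition _ I :=
  GRing.isMonoidMorphism.Build A (algQuot I) (aproj I) (aproj_monoid I).

End Ideal.

(* All modules are k-modules on which the scalars act compatibly with the
    algebra; in particular k acts centrally on bimodules. *)

HB.mixin Record isLeftModule (k : pzRingType) (A : pzAlgType k) M
    of GRing.Lmodule k M := {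
  lact : A -> M -> M;
  lactDl : forall a b m, lact (a + b) m = lact a m + lact b m;
  lactDr : forall a m n, lact a (m + n) = lact a m + lact a n;
  lactZl : forall (c : k) a m, lact (c *: a) m = c *: lact a m;
  lactZr : forall (c : k) a m, lact a (c *: m) = c *: lact a m;
  lactM : forall a b m, lact (a * b) m = lact a (lact b m);
  lact1 : forall m, lact 1 m = m
}.
#[short(type="leftModType")]
HB.structure Definition LeftModule (k : pzRingType) (A : pzAlgType k) :=
  { M of GRing.Lmodule k M & isLeftModule k A M }.

HB.mixin Record isRightModule (k : pzRingType) (B : pzAlgType k) M
    of GRing.Lmodule k M := {
  ract : M -> B -> M;
  ractDl : forall m n b, ract (m + n) b = ract m b + ract n b;
  ractDr : forall m a b, ract m (a + b) = ract m a + ract m b;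
  ractZl : forall (c : k) m b, ract (c *: m) b = c *: ract m b;
  ractZr : forall (c : k) m b, ract m (c *: b) = c *: ract m b;
  ractM : forall m a b, ract m (a * b) = ract (ract m a) b;
  ract1 : forall m, ract m 1 = m
}.
#[short(type="rightModType")]
HB.structure Definition RightModule (k : pzRingType) (B : pzAlgType k) :=
  { M of GRing.Lmodule k M & isRightModule k B M }.

HB.mixin Record isBimodule (k : pzRingType) (A B : pzAlgType k) M
    of LeftModule k A M & RightModule k B M := {
  lractA : forall (a : A) (m : M) (b : B), lact a (ract m b) = ract (lact a m) b
}.
#[short(type="bimodType")]
HB.structure Definition Bimodule (k : pzRingType) (A B : pzAlgType k) :=
  { M of LeftModule k A M & RightModule k B M & isBimodule k A B M }.

Lemma lact0r k (A : pzAlgType k) (M : leftModType A) (a : A) :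
  lact a (0 : M) = 0.
Proof. by rewrite -[X in lact a X](scale0r 0) lactZr scale0r. Qed.

Lemma ract0l k (B : pzAlgType k) (M : rightModType B) (b : B) :
  ract (0 : M) b = 0.
Proof. by rewrite -[X in ract X b](scale0r 0) ractZl scale0r. Qed.

Section Hom.
Variables (k : pzRingType) (A B : pzAlgType k).

Definition rmodule_hom (M N : rightModType B) (f : M -> N) : Prop :=
  linear f /\ forall m b, f (ract m b) = ract (f m) b.

Definition bimodule_hom (M N : bimodType A B) (f : M -> N) : Prop :=
  [/\ linear f, forall (a : A) m, f (lact a m) = lact a (f m) &
      forall m (b : B), f (ract m b) = ract (f m) b].

Definition bimodule_iso (M N : bimodType A B) : Prop :=
  exists2 f : M -> N, bimodule_hom f & bijective f.

Definition bimodule_projective (P : bimodType A B) : Prop :=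
  forall (M N : bimodType A B) (g : M -> N) (h : P -> N),
    bimodule_hom g -> (forall n, exists m, g m = n) -> bimodule_hom h ->
  exists2 h' : P -> M, bimodule_hom h' & forall p, g (h' p) = h p.

End Hom.

Section RHom.
Variables (k : fieldType) (B : pzAlgType k) (M N : rightModType B).

Definition rHom_submodule : submodule (M -> N).
Proof.
exists (@rmodule_hom k B M N).
- by split=> [c x y|m b] /=; rewrite ?scaler0 ?addr0 ?ract0l.
- have addE (f g : M -> N) x : (f + g) x = f x + g x by [].
  move=> f g [fL fB] [gL gB]; split=> [c x y|m b].
    by rewrite !addE fL gL scalerDr addrACA.
  by rewrite !addE fB gB ractDl.
- have scaleE d (f : M -> N) x : (d *: f) x = d *: f x by [].
  move=> d f [fL fB]; split=> [c x y|m b].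
    by rewrite !scaleE fL scalerDr !scalerA mulrC.
  by rewrite !scaleE fB ractZl.
Defined.

Definition rHom : Type := submodule_type rHom_submodule.
HB.instance Definition _ := GRing.Lmodule.on rHom.

End RHom.

Section Corners.
Variables (k : fieldType) (A : pzAlgType k).

Definition left_ideal_of (e : A) : submodule A.
Proof.
exists (fun x => exists y, x = y * e) => [|x y [u ->] [v ->]|c x [u ->]].
- by exists 0; rewrite mul0r.
- by exists (u + v); rewrite mulrDl.
- by exists (c *: u); rewrite pzscalerAl.
Defined.

Definition right_ideal_of (e : A) : submodule A.
Proof.
exists (fun x => exists y, x = e * y) => [|x y [u ->] [v ->]|c x [u ->]].
- by exists 0; rewrite mulr0.
- by exists (u + v); rewrite mulrDr.
- by exists (c *: u); rewrite pzscalerAr.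
Defined.

Definition corner_of (f e : A) : submodule A.
Proof.
exists (fun x => exists y, x = f * y * e) => [|x y [u ->] [v ->]|c x [u ->]].
- by exists 0; rewrite mulr0 mul0r.
- by exists (u + v); rewrite mulrDr mulrDl.
- by exists (c *: u); rewrite -pzscalerAr -pzscalerAl.
Defined.

Definition leftPart (e : A) : Type := submodule_type (left_ideal_of e).
Definition rightPart (e : A) : Type := submodule_type (right_ideal_of e).
Definition corner (f e : A) : Type := submodule_type (corner_of f e).

HB.instance Definition _ e := GRing.Lmodule.on (leftPart e).
HB.instance Definition _ e := GRing.Lmodule.on (rightPart e).
HB.instance Definition _ f e := GRing.Lmodule.on (corner f e).

Fact leftPart_subproof e (a : A) (m : leftPart e) :
  submodule_pred (left_ideal_of e) (a * val m).
Proof.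
by case: m => x /= /asboolP [y ->]; apply/asboolP; exists (a * y); rewrite mulrA.
Qed.
Definition leftPart_act e (a : A) (m : leftPart e) : leftPart e :=
  exist _ (a * val m) (leftPart_subproof a m).

Fact rightPart_subproof e (m : rightPart e) (a : A) :
  submodule_pred (right_ideal_of e) (val m * a).
Proof.
by case: m => x /= /asboolP [y ->]; apply/asboolP; exists (y * a); rewrite mulrA.
Qed.
Definition rightPart_act e (m : rightPart e) (a : A) : rightPart e :=
  exist _ (val m * a) (rightPart_subproof m a).

Section LeftPart.
Variable e : A.
Local Notation act := (@leftPart_act e).
Fact leftPartDl a b m : act (a + b) m = act a m + act b m.
Proof. by apply: val_inj; apply: mulrDl. Qed.
Fact leftPartDr a m n : act a (m + n) = act a m + act a n.
Proof. by apply: val_inj; apply: mulrDr. Qed.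
Fact leftPartZl (c : k) a m : act (c *: a) m = c *: act a m.
Proof. by apply: val_inj; rewrite /= -pzscalerAl. Qed.
Fact leftPartZr (c : k) a m : act a (c *: m) = c *: act a m.
Proof. by apply: val_inj; rewrite /= -pzscalerAr. Qed.
Fact leftPartM a b m : act (a * b) m = act a (act b m).
Proof. by apply: val_inj; rewrite /= mulrA. Qed.
Fact leftPart1 m : act 1 m = m.
Proof. by apply: val_inj; rewrite /= mul1r. Qed.
HB.instance Definition _ := isLeftModule.Build k A (leftPart e)
  leftPartDl leftPartDr leftPartZl leftPartZr leftPartM leftPart1.
End LeftPart.

Section RightPart.
Variable e : A.
Local Notation act := (@rightPart_act e).
Fact rightPartDl m n b : act (m + n) b = act m b + act n b.
Proof. by apply: val_inj; apply: mulrDl. Qed.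
Fact rightPartDr m a b : act m (a + b) = act m a + act m b.
Proof. by apply: val_inj; apply: mulrDr. Qed.
Fact rightPartZl (c : k) m b : act (c *: m) b = c *: act m b.
Proof. by apply: val_inj; rewrite /= -pzscalerAl. Qed.
Fact rightPartZr (c : k) m b : act m (c *: b) = c *: act m b.
Proof. by apply: val_inj; rewrite /= -pzscalerAr. Qed.
Fact rightPartM m a b : act m (a * b) = act (act m a) b.
Proof. by apply: val_inj; rewrite /= mulrA. Qed.
Fact rightPart1 m : act m 1 = m.
Proof. by apply: val_inj; rewrite /= mulr1. Qed.
HB.instance Definition _ := isRightModule.Build k A (rightPart e)
  rightPartDl rightPartDr rightPartZl rightPartZr rightPartM rightPart1.
End RightPart.

End Corners.

Section Constructions.
Variables (k : fieldType) (A B : pzAlgType k).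

Section DirectSum.
Variables (t : nat) (P : 'I_t -> bimodType A B).

Definition dsum : Type := forall i, P i.
HB.instance Definition _ := Choice.on dsum.
Implicit Types (x y z : dsum) (c d : k).

Definition dsum_zero : dsum := fun=> 0.
Definition dsum_opp x : dsum := fun i => - x i.
Definition dsum_add x y : dsum := fun i => x i + y i.
Definition dsum_scale c x : dsum := fun i => c *: x i.
Definition dsum_lact (a : A) x : dsum := fun i => lact a (x i).
Definition dsum_ract x (b : B) : dsum := fun i => ract (x i) b.

Fact dsum_addA : associative dsum_add.
Proof. by move=> x y z; apply: functional_extensionality_dep => i; apply: addrA. Qed.
Fact dsum_addC : commutative dsum_add.
Proof. by move=> x y; apply: functional_extensionality_dep => i; apply: addrC. Qed.
Fact dsum_add0 : left_id dsum_zero dsum_add.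
Proof. by move=> x; apply: functional_extensionality_dep => i; apply: add0r. Qed.
Fact dsum_addN : left_inverse dsum_zero dsum_opp dsum_add.
Proof. by move=> x; apply: functional_extensionality_dep => i; apply: addNr. Qed.
HB.instance Definition _ :=
  GRing.isZmodule.Build dsum dsum_addA dsum_addC dsum_add0 dsum_addN.

Fact dsum_scaleA c d x : dsum_scale c (dsum_scale d x) = dsum_scale (c * d) x.
Proof. by apply: functional_extensionality_dep => i; apply: scalerA. Qed.
Fact dsum_scale1 : left_id 1 dsum_scale.
Proof. by move=> x; apply: functional_extensionality_dep => i; apply: scale1r. Qed.
Fact dsum_scaleDr : right_distributive dsum_scale +%R.
Proof. by move=> c x y; apply: functional_extensionality_dep => i; apply: scalerDr. Qed.
Fact dsum_scaleDl x : {morph dsum_scale^~ x : c d / c + d}.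
Proof. by move=> c d; apply: functional_extensionality_dep => i; apply: scalerDl. Qed.
HB.instance Definition _ := GRing.Zmodule_isLmodule.Build k dsum
  dsum_scaleA dsum_scale1 dsum_scaleDr dsum_scaleDl.

Fact dsum_lactDl a b x : dsum_lact (a + b) x = dsum_lact a x + dsum_lact b x.
Proof. by apply: functional_extensionality_dep => i; apply: lactDl. Qed.
Fact dsum_lactDr a x y : dsum_lact a (x + y) = dsum_lact a x + dsum_lact a y.
Proof. by apply: functional_extensionality_dep => i; apply: lactDr. Qed.
Fact dsum_lactZl c a x : dsum_lact (c *: a) x = c *: dsum_lact a x.
Proof. by apply: functional_extensionality_dep => i; apply: lactZl. Qed.
Fact dsum_lactZr c a x : dsum_lact a (c *: x) = c *: dsum_lact a x.
Proof. by apply: functional_extensionality_dep => i; apply: lactZr. Qed.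
Fact dsum_lactM a b x : dsum_lact (a * b) x = dsum_lact a (dsum_lact b x).
Proof. by apply: functional_extensionality_dep => i; apply: lactM. Qed.
Fact dsum_lact1 x : dsum_lact 1 x = x.
Proof. by apply: functional_extensionality_dep => i; apply: lact1. Qed.
HB.instance Definition _ := isLeftModule.Build k A dsum
  dsum_lactDl dsum_lactDr dsum_lactZl dsum_lactZr dsum_lactM dsum_lact1.

Fact dsum_ractDl x y b : dsum_ract (x + y) b = dsum_ract x b + dsum_ract y b.
Proof. by apply: functional_extensionality_dep => i; apply: ractDl. Qed.
Fact dsum_ractDr x a b : dsum_ract x (a + b) = dsum_ract x a + dsum_ract x b.
Proof. by apply: functional_extensionality_dep => i; apply: ractDr. Qed.
Fact dsum_ractZl c x b : dsum_ract (c *: x) b = c *: dsum_ract x b.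
Proof. by apply: functional_extensionality_dep => i; apply: ractZl. Qed.
Fact dsum_ractZr c x b : dsum_ract x (c *: b) = c *: dsum_ract x b.
Proof. by apply: functional_extensionality_dep => i; apply: ractZr. Qed.
Fact dsum_ractM x a b : dsum_ract x (a * b) = dsum_ract (dsum_ract x a) b.
Proof. by apply: functional_extensionality_dep => i; apply: ractM. Qed.
Fact dsum_ract1 x : dsum_ract x 1 = x.
Proof. by apply: functional_extensionality_dep => i; apply: ract1. Qed.
HB.instance Definition _ := isRightModule.Build k B dsum
  dsum_ractDl dsum_ractDr dsum_ractZl dsum_ractZr dsum_ractM dsum_ract1.

Fact dsum_lractA (a : A) (x : dsum) (b : B) :
  lact a (ract x b) = ract (lact a x) b.
Proof. by apply: functional_extensionality_dep => i; apply: lractA. Qed.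
HB.instance Definition _ := isBimodule.Build k A B dsum dsum_lractA.

End DirectSum.

Section Lext.
Variables (K : choiceType) (V : lmodType k) (f : K -> V).

Definition lext (x : {malg k[K]}) : V := \sum_(i <- msupp x) x@_i *: f i.

Lemma lextw (D : {fset K}) (x : {malg k[K]}) : (msupp x `<=` D)%fset ->
  lext x = \sum_(i <- D) x@_i *: f i.
Proof.
move=> sxD; rewrite /lext; apply: big_fset_incl => // i _ /mcoeff_outdom ->.
exact: scale0r.
Qed.

Fact lext_linear : linear lext.
Proof.
move=> c x y; pose D := (msupp x `|` msupp y)%fset.
rewrite (@lextw D x) ?fsubsetUl // (@lextw D y) ?fsubsetUr //.
rewrite (@lextw D (c *: x + y)).
  rewrite scaler_sumr -big_split /=; apply: eq_bigr => i _.
  by rewrite mcoeffD mcoeffZ scalerDl scalerA.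
apply: fsubset_trans (msuppD_le _ _) _.
by apply: fsetSU; apply: msuppZ_le.
Qed.
HB.instance Definition _ := GRing.isLinear.Build k {malg k[K]} V *:%R lext
  lext_linear.

Lemma lextU i : lext << i >> = f i.
Proof. by rewrite (lextw msuppU_le) big_seq_fset1 mcoeffUU scale1r. Qed.

End Lext.

Lemma malgUZ (K : choiceType) (c : k) (i : K) :
  << c *g i >> = c *: << i >> :> {malg k[K]}.
Proof. by apply/malgP => j; rewrite mcoeffZ !mcoeffU mulr_natr. Qed.

Lemma malg_ind_linear (K : choiceType) (V : lmodType k)
    (f g : {linear {malg k[K]} -> V}) :
  (forall i, f << i >> = g << i >>) -> f =1 g.
Proof.
move=> fg x; rewrite [x]monalgE !raddf_sum; apply: eq_bigr => i _.
by rewrite malgUZ /= !linearZ fg.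
Qed.

Section Tensor.
Variables (U : leftModType A) (W : rightModType B).
Implicit Types (u v : U) (w z : W).
Local Notation free := {malg k[(U * W)%type]}.

Definition tensor_rel (x : free) : Prop :=
  [\/ exists u v w, x = << (u + v, w) >> - << (u, w) >> - << (v, w) >>,
      exists u w z, x = << (u, w + z) >> - << (u, w) >> - << (u, z) >>,
      exists (c : k) u w, x = << (c *: u, w) >> - c *: << (u, w) >> |
      exists (c : k) u w, x = << (u, c *: w) >> - c *: << (u, w) >>].

Definition tensor : Type := lquot (span tensor_rel).
HB.instance Definition _ := GRing.Lmodule.on tensor.

Fact tens_key : unit. Proof. by []. Qed.
Definition tens : U -> W -> tensor := locked_with tens_key
  (fun u w => cls (span tensor_rel) << (u, w) >>).
Canonical tens_unlockable := [unlockable of tens].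

Lemma tensDl u v w : tens (u + v) w = tens u w + tens v w.
Proof.
apply/eqP; rewrite unlock -subr_eq0 opprD addrA -!raddfB; apply/eqP/cls_eq0/span_gen.
by constructor 1; exists u, v, w.
Qed.
Lemma tensDr u w z : tens u (w + z) = tens u w + tens u z.
Proof.
apply/eqP; rewrite unlock -subr_eq0 opprD addrA -!raddfB; apply/eqP/cls_eq0/span_gen.
by constructor 2; exists u, w, z.
Qed.
Lemma tensZl (c : k) u w : tens (c *: u) w = c *: tens u w.
Proof.
apply/eqP; rewrite unlock -subr_eq0 -linearZ -raddfB; apply/eqP/cls_eq0/span_gen.
by constructor 3; exists c, u, w.
Qed.
Lemma tensZr (c : k) u w : tens u (c *: w) = c *: tens u w.
Proof.
apply/eqP; rewrite unlock -subr_eq0 -linearZ -raddfB; apply/eqP/cls_eq0/span_gen.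
by constructor 4; exists c, u, w.
Qed.

Section Lift.
Variables (V : lmodType k) (f : U -> W -> V).
Hypotheses (fDl : forall u v w, f (u + v) w = f u w + f v w)
           (fDr : forall u w z, f u (w + z) = f u w + f u z)
           (fZl : forall (c : k) u w, f (c *: u) w = c *: f u w)
           (fZr : forall (c : k) u w, f u (c *: w) = c *: f u w).

Lemma tensor_lift_rel x : span tensor_rel x -> lext (fun p => f p.1 p.2) x = 0.
Proof.
pose F := lext (fun p : U * W => f p.1 p.2).
have S0 : F 0 = 0 by exact: raddf0.
have SD y y' : F y = 0 -> F y' = 0 -> F (y + y') = 0.
  by move=> y0 y0'; rewrite /F raddfD /= -/(F y) -/(F y') y0 y0' addr0.
have SZ (c : k) y : F y = 0 -> F (c *: y) = 0.
  by move=> y0; rewrite /F linearZ /= -/(F y) y0 scaler0.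
apply: (@span_min _ _ _ (Submodule S0 SD SZ)) => {}x /=.
case=> [[u [v [w ->]]]|[u [w [z ->]]]|[c [u [w ->]]]|[c [u [w ->]]]].
- by rewrite /F !raddfB /= !lextU /= fDl -addrA -opprD subrr.
- by rewrite /F !raddfB /= !lextU /= fDr -addrA -opprD subrr.
- by rewrite /F raddfB /= linearZ /= !lextU /= fZl subrr.
- by rewrite /F raddfB /= linearZ /= !lextU /= fZr subrr.
Qed.

Definition tensor_lift (x : tensor) : V :=
  lquot_lift (lext (fun p => f p.1 p.2)) x.

Lemma tensor_lift_cls x :
  tensor_lift (cls (span tensor_rel) x) = lext (fun p => f p.1 p.2) x.
Proof. exact/lquot_liftE/tensor_lift_rel. Qed.

Lemma tensor_liftE u w : tensor_lift (tens u w) = f u w.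
Proof. by rewrite unlock tensor_lift_cls lextU. Qed.

Lemma tensor_lift_linear : linear tensor_lift.
Proof.
move=> c x y; have [x' ->] := cls_surj x; have [y' ->] := cls_surj y.
by rewrite -linearP !tensor_lift_cls linearP.
Qed.

End Lift.

Lemma tensor_ext (V : lmodType k) (f g : tensor -> V) : linear f -> linear g ->
  (forall u w, f (tens u w) = g (tens u w)) -> f =1 g.
Proof.
move=> fL gL fg x; have [{}x ->] := cls_surj x.
pose F := f \o cls (span tensor_rel); pose G := g \o cls (span tensor_rel).
have FL : linear F by move=> c y z; rewrite /F /= linearP fL.
have GL : linear G by move=> c y z; rewrite /G /= linearP gL.
pose F' := GRing.isLinear.Build k free V *:%R F FL.
pose G' := GRing.isLinear.Build k free V *:%R G GL.
pose Fl : {linear free -> V} := HB.pack F F'.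
pose Gl : {linear free -> V} := HB.pack G G'.
by apply: (@malg_ind_linear _ _ Fl Gl) => -[u w]; have := fg u w; rewrite unlock.
Qed.

Definition tensor_lact (a : A) : tensor -> tensor :=
  tensor_lift (fun u w => tens (lact a u) w).
Definition tensor_ract (x : tensor) (b : B) : tensor :=
  tensor_lift (fun u w => tens u (ract w b)) x.

Fact tensor_lact_linear a : linear (tensor_lact a).
Proof.
apply: tensor_lift_linear => *; rewrite ?lactDr ?lactZr.
- exact: tensDl.
- exact: tensDr.
- exact: tensZl.
- exact: tensZr.
Qed.
Fact tensor_ract_linear b : linear (tensor_ract^~ b).
Proof.
apply: tensor_lift_linear => *; rewrite ?ractDl ?ractZl.
- exact: tensDl.
- exact: tensDr.
- exact: tensZl.
- exact: tensZr.
Qed.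
Lemma tensor_lactE a u w : tensor_lact a (tens u w) = tens (lact a u) w.
Proof.
apply: tensor_liftE => *; rewrite ?lactDr ?lactZr.
- exact: tensDl.
- exact: tensDr.
- exact: tensZl.
- exact: tensZr.
Qed.
Lemma tensor_ractE u w b : tensor_ract (tens u w) b = tens u (ract w b).
Proof.
apply: (@tensor_liftE _ (fun u w => tens u (ract w b))) => *;
  rewrite ?ractDl ?ractZl.
- exact: tensDl.
- exact: tensDr.
- exact: tensZl.
- exact: tensZr.
Qed.

Fact tensor_lactDr a x y :
  tensor_lact a (x + y) = tensor_lact a x + tensor_lact a y.
Proof. by have := tensor_lact_linear a 1 x y; rewrite !scale1r. Qed.
Fact tensor_lactZr (c : k) a x : tensor_lact a (c *: x) = c *: tensor_lact a x.
Proof.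
have := tensor_lact_linear a c x 0; rewrite !addr0 => ->.
have := tensor_lact_linear a 1 0 0; rewrite !scale1r !addr0 => /eqP.
by rewrite -subr_eq0 opprD addrA subrr sub0r oppr_eq0 => /eqP ->; rewrite addr0.
Qed.
Fact tensor_lactDl a b x :
  tensor_lact (a + b) x = tensor_lact a x + tensor_lact b x.
Proof.
apply: (tensor_ext (tensor_lact_linear _)
  (g := fun x => tensor_lact a x + tensor_lact b x)).
  by move=> c y z; rewrite !tensor_lact_linear scalerDr addrACA.
by move=> u w; rewrite !tensor_lactE lactDl tensDl.
Qed.
Fact tensor_lactZl (c : k) a x : tensor_lact (c *: a) x = c *: tensor_lact a x.
Proof.
apply: (tensor_ext (tensor_lact_linear _) (g := fun x => c *: tensor_lact a x)).
  by move=> d y z; rewrite tensor_lact_linear scalerDr !scalerA mulrC.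
by move=> u w; rewrite !tensor_lactE lactZl tensZl.
Qed.
Fact tensor_lactM a b x : tensor_lact (a * b) x = tensor_lact a (tensor_lact b x).
Proof.
apply: (tensor_ext (tensor_lact_linear _)
  (g := fun x => tensor_lact a (tensor_lact b x))).
  by move=> c y z; rewrite !tensor_lact_linear.
by move=> u w; rewrite !tensor_lactE lactM.
Qed.
Fact tensor_lact1 x : tensor_lact 1 x = x.
Proof.
apply: (tensor_ext (tensor_lact_linear _) (g := id)) => // u w.
by rewrite tensor_lactE lact1.
Qed.
HB.instance Definition _ := isLeftModule.Build k A tensor
  tensor_lactDl tensor_lactDr tensor_lactZl tensor_lactZr
  tensor_lactM tensor_lact1.

Fact tensor_ractDl x y b :
  tensor_ract (x + y) b = tensor_ract x b + tensor_ract y b.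
Proof. by have := tensor_ract_linear b 1 x y; rewrite !scale1r. Qed.
Fact tensor_ractZl (c : k) x b : tensor_ract (c *: x) b = c *: tensor_ract x b.
Proof.
have := tensor_ract_linear b c x 0; rewrite !addr0 => ->.
have := tensor_ract_linear b 1 0 0; rewrite !scale1r !addr0 => /eqP.
by rewrite -subr_eq0 opprD addrA subrr sub0r oppr_eq0 => /eqP ->; rewrite addr0.
Qed.
Fact tensor_ractDr x a b :
  tensor_ract x (a + b) = tensor_ract x a + tensor_ract x b.
Proof.
apply: (tensor_ext (@tensor_ract_linear _)
  (g := fun x => tensor_ract x a + tensor_ract x b)).
  by move=> c y z; rewrite !tensor_ract_linear scalerDr addrACA.
by move=> u w; rewrite !tensor_ractE ractDr tensDr.
Qed.
Fact tensor_ractZr (c : k) x b : tensor_ract x (c *: b) = c *: tensor_ract x b.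
Proof.
apply: (tensor_ext (@tensor_ract_linear _) (g := fun x => c *: tensor_ract x b)).
  by move=> d y z; rewrite tensor_ract_linear scalerDr !scalerA mulrC.
by move=> u w; rewrite !tensor_ractE ractZr tensZr.
Qed.
Fact tensor_ractM x a b : tensor_ract x (a * b) = tensor_ract (tensor_ract x a) b.
Proof.
apply: (tensor_ext (@tensor_ract_linear _)
  (g := fun x => tensor_ract (tensor_ract x a) b)).
  by move=> c y z; rewrite !tensor_ract_linear.
by move=> u w; rewrite !tensor_ractE ractM.
Qed.
Fact tensor_ract1 x : tensor_ract x 1 = x.
Proof.
apply: (tensor_ext (@tensor_ract_linear _) (g := id)) => // u w.
by rewrite tensor_ractE ract1.
Qed.
HB.instance Definition _ := isRightModule.Build k B tensor
  tensor_ractDl tensor_ractDr tensor_ractZl tensor_ractZr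
  tensor_ractM tensor_ract1.

Fact tensor_lractA (a : A) (x : tensor) (b : B) :
  lact a (ract x b) = ract (lact a x) b.
Proof.
apply: (tensor_ext (f := fun x => tensor_lact a (tensor_ract x b))
                   (g := fun x => tensor_ract (tensor_lact a x) b)).
- by move=> c y z; rewrite tensor_ract_linear tensor_lact_linear.
- by move=> c y z; rewrite tensor_lact_linear tensor_ract_linear.
- by move=> u w; rewrite tensor_ractE !tensor_lactE tensor_ractE.
Qed.
HB.instance Definition _ := isBimodule.Build k A B tensor tensor_lractA.

End Tensor.

End Constructions.

Section IdealBimodule.
Variables (k : fieldType) (C A : pzAlgType k).

(** nu is a phantom argument: it selects the bimodule structure. *)
Definition idealBimod (nu : algHom C A) (I : ideal A) : Type :=
  submodule_type I.
HB.instance Definition _ nu I := SubChoice.on (idealBimod nu I).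
HB.instance Definition _ nu I := GRing.Lmodule.on (idealBimod nu I).

Variables (nu : algHom C A) (I : ideal A).
Implicit Types (a b : C) (m n : idealBimod nu I).

Fact idealBimod_lact_subproof a m : submodule_pred I (nu a * val m).
Proof. by apply/asboolP/idealMl/asboolP/(valP m). Qed.
Fact idealBimod_ract_subproof m b : submodule_pred I (val m * nu b).
Proof. by apply/asboolP/idealMr/asboolP/(valP m). Qed.

Definition idealBimod_lact a m : idealBimod nu I :=
  exist _ (nu a * val m) (idealBimod_lact_subproof a m).
Definition idealBimod_ract m b : idealBimod nu I :=
  exist _ (val m * nu b) (idealBimod_ract_subproof m b).
Local Notation la := idealBimod_lact.
Local Notation ra := idealBimod_ract.

Fact idealBimod_lactDl a b m : la (a + b) m = la a m + la b m.
Proof. by apply: val_inj; rewrite /= rmorphD mulrDl. Qed.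
Fact idealBimod_lactDr a m n : la a (m + n) = la a m + la a n.
Proof. by apply: val_inj; rewrite /= mulrDr. Qed.
Fact idealBimod_lactZl (c : k) a m : la (c *: a) m = c *: la a m.
Proof. by apply: val_inj; rewrite /= algHomZ -pzscalerAl. Qed.
Fact idealBimod_lactZr (c : k) a m : la a (c *: m) = c *: la a m.
Proof. by apply: val_inj; rewrite /= -pzscalerAr. Qed.
Fact idealBimod_lactM a b m : la (a * b) m = la a (la b m).
Proof. by apply: val_inj; rewrite /= rmorphM mulrA. Qed.
Fact idealBimod_lact1 m : la 1 m = m.
Proof. by apply: val_inj; rewrite /= rmorph1 mul1r. Qed.
HB.instance Definition _ := isLeftModule.Build k C (idealBimod nu I)
  idealBimod_lactDl idealBimod_lactDr idealBimod_lactZl idealBimod_lactZr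
  idealBimod_lactM idealBimod_lact1.

Fact idealBimod_ractDl m n b : ra (m + n) b = ra m b + ra n b.
Proof. by apply: val_inj; rewrite /= mulrDl. Qed.
Fact idealBimod_ractDr m a b : ra m (a + b) = ra m a + ra m b.
Proof. by apply: val_inj; rewrite /= rmorphD mulrDr. Qed.
Fact idealBimod_ractZl (c : k) m b : ra (c *: m) b = c *: ra m b.
Proof. by apply: val_inj; rewrite /= -pzscalerAl. Qed.
Fact idealBimod_ractZr (c : k) m b : ra m (c *: b) = c *: ra m b.
Proof. by apply: val_inj; rewrite /= algHomZ -pzscalerAr. Qed.
Fact idealBimod_ractM m a b : ra m (a * b) = ra (ra m a) b.
Proof. by apply: val_inj; rewrite /= rmorphM mulrA. Qed.
Fact idealBimod_ract1 m : ra m 1 = m.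
Proof. by apply: val_inj; rewrite /= rmorph1 mulr1. Qed.
HB.instance Definition _ := isRightModule.Build k C (idealBimod nu I)
  idealBimod_ractDl idealBimod_ractDr idealBimod_ractZl idealBimod_ractZr
  idealBimod_ractM idealBimod_ract1.

Fact idealBimod_lractA a m b : la a (ra m b) = ra (la a m) b.
Proof. by apply: val_inj; rewrite /= mulrA. Qed.
HB.instance Definition _ := isBimodule.Build k C C (idealBimod nu I)
  idealBimod_lractA.

End IdealBimodule.

Section TrivialExtension.
Variables (k : fieldType) (A : pzAlgType k) (P : bimodType A A).

Definition trivExt : Type := (A * P)%type.
HB.instance Definition _ := GRing.Zmodule.on trivExt.
Implicit Types x y z : trivExt.

Definition te_mul x y : trivExt :=
  (x.1 * y.1, lact x.1 y.2 + ract x.2 y.1).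
Definition te_one : trivExt := (1, 0).
Definition te_scale (c : k) x : trivExt := (c *: x.1, c *: x.2).

Fact te_mulA : associative te_mul.
Proof.
move=> [a p] [b q] [c r]; rewrite /te_mul /= mulrA; congr (_, _).
by rewrite lactDr ractDl lactM ractM lractA addrA.
Qed.
Fact te_mul1r : left_id te_one te_mul.
Proof. by case=> a p; rewrite /te_mul /= mul1r lact1 ract0l addr0. Qed.
Fact te_mulr1 : right_id te_one te_mul.
Proof. by case=> a p; rewrite /te_mul /= mulr1 ract1 lact0r add0r. Qed.
Fact te_mulDl : left_distributive te_mul +%R.
Proof.
move=> [a p] [b q] [c r]; rewrite /te_mul /= mulrDl; congr (_, _).
by rewrite lactDl ractDl addrACA.
Qed.
Fact te_mulDr : right_distributive te_mul +%R.
Proof.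
move=> [a p] [b q] [c r]; rewrite /te_mul /= mulrDr; congr (_, _).
by rewrite lactDr ractDr addrACA.
Qed.
HB.instance Definition _ := GRing.Zmodule_isPzRing.Build trivExt
  te_mulA te_mul1r te_mulr1 te_mulDl te_mulDr.

Fact te_scaleA c d x : te_scale c (te_scale d x) = te_scale (c * d) x.
Proof. by rewrite /te_scale /= !scalerA. Qed.
Fact te_scale1 : left_id 1 te_scale.
Proof. by case=> a p; rewrite /te_scale /= !scale1r. Qed.
Fact te_scaleDr : right_distributive te_scale +%R.
Proof. by move=> c [a p] [b q]; rewrite /te_scale /= !scalerDr. Qed.
Fact te_scaleDl x : {morph te_scale^~ x : c d / c + d}.
Proof. by move=> c d; rewrite /te_scale /= !scalerDl. Qed.
Fact te_scaleAl c x y : te_scale c (x * y) = te_scale c x * y.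
Proof.
case: x y => [a p] [b q]; rewrite /te_scale /GRing.mul /= /te_mul /=.
by rewrite scalerDr pzscalerAl lactZl ractZl.
Qed.
Fact te_scaleAr c x y : te_scale c (x * y) = x * te_scale c y.
Proof.
case: x y => [a p] [b q]; rewrite /te_scale /GRing.mul /= /te_mul /=.
by rewrite scalerDr pzscalerAr lactZr ractZr.
Qed.
HB.instance Definition _ := isPzAlgebra.Build k trivExt
  te_scaleA te_scale1 te_scaleDr te_scaleDl te_scaleAl te_scaleAr.

End TrivialExtension.

Record quiver := Quiver {
  vertex : finType;
  arrow : finType;
  source : arrow -> vertex;
  target : arrow -> vertex
}.

Fixpoint is_walk (Q : quiver) (v : vertex Q) (s : seq (arrow Q)) : bool :=
  if s is a :: s' then (source a == v) && is_walk (target a) s' else true.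

(** A path is its starting vertex and the sequence of its arrows, read from
    left to right. *)
Definition qpath (Q : quiver) : Type :=
  {p : vertex Q * seq (arrow Q) | is_walk p.1 p.2}.
HB.instance Definition _ Q := SubChoice.on (qpath Q).

Section PathAlgebra.
Variables (k : fieldType) (Q : quiver).
Implicit Types (p q r : qpath Q) (v : vertex Q) (a : arrow Q).

Definition path_start p : vertex Q := (val p).1.
Definition path_arrows p : seq (arrow Q) := (val p).2.
Definition path_end p : vertex Q :=
  last (path_start p) (map (@target Q) (path_arrows p)).

Definition path_vertex v : qpath Q := exist _ (v, [::]) isT.
Fact path_arrow_subproof a : is_walk (source a) [:: a].
Proof. by rewrite /= eqxx. Qed.
Definition path_arrow a : qpath Q :=
  exist _ (source a, [:: a]) (path_arrow_subproof a).

(** concatenation; None when the end of p is not the start of q *)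
Definition path_cat p q : option (qpath Q) :=
  if path_end p == path_start q
  then insub (path_start p, path_arrows p ++ path_arrows q) else None.

(** The vector space on the paths.  It is {malg k[qpath Q]}, wrapped and with
    locked operations, as unification otherwise unfolds the finite maps behind
    the operations of malg. *)
Record pathAlg : Type := PathAlg { pa_malg : {malg k[qpath Q]} }.
HB.instance Definition _ := [isNew for pa_malg].
HB.instance Definition _ := [Choice of pathAlg by <:].
Implicit Types x y z : pathAlg.

Fact pa_key : unit. Proof. by []. Qed.
Definition pa_zero : pathAlg := locked_with pa_key (PathAlg 0).
Definition pa_opp : pathAlg -> pathAlg :=
  locked_with pa_key (fun x => PathAlg (- pa_malg x)).
Definition pa_add : pathAlg -> pathAlg -> pathAlg :=
  locked_with pa_key (fun x y => PathAlg (pa_malg x + pa_malg y)).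
Definition pa_scale : k -> pathAlg -> pathAlg :=
  locked_with pa_key (fun c x => PathAlg (c *: pa_malg x)).
Definition basis_path : qpath Q -> pathAlg :=
  locked_with pa_key (fun p => PathAlg << p >>).
Canonical pa_zero_unlockable := [unlockable of pa_zero].
Canonical pa_opp_unlockable := [unlockable of pa_opp].
Canonical pa_add_unlockable := [unlockable of pa_add].
Canonical pa_scale_unlockable := [unlockable of pa_scale].
Canonical basis_path_unlockable := [unlockable of basis_path].

Fact pa_addA : associative pa_add.
Proof. by move=> x y z; rewrite [pa_add]unlock /= addrA. Qed.
Fact pa_addC : commutative pa_add.
Proof. by move=> x y; rewrite [pa_add]unlock /= addrC. Qed.
Fact pa_add0 : left_id pa_zero pa_add.
Proof. by case=> x; rewrite [pa_add]unlock [pa_zero]unlock /= add0r. Qed.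
Fact pa_addN : left_inverse pa_zero pa_opp pa_add.
Proof.
by case=> x; rewrite [pa_add]unlock [pa_opp]unlock [pa_zero]unlock /= addNr.
Qed.
HB.instance Definition _ :=
  GRing.isZmodule.Build pathAlg pa_addA pa_addC pa_add0 pa_addN.

Fact pa_scaleA c d x : pa_scale c (pa_scale d x) = pa_scale (c * d) x.
Proof. by rewrite [pa_scale]unlock /= scalerA. Qed.
Fact pa_scale1 : left_id 1 pa_scale.
Proof. by case=> x; rewrite [pa_scale]unlock /= scale1r. Qed.
Fact pa_scaleDr : right_distributive pa_scale +%R.
Proof.
move=> c x y; rewrite [pa_scale]unlock /GRing.add /= [pa_add]unlock /=.
by rewrite scalerDr.
Qed.
Fact pa_scaleDl x : {morph pa_scale^~ x : c d / c + d}.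
Proof.
move=> c d; rewrite [pa_scale]unlock /GRing.add /= [pa_add]unlock /=.
by rewrite scalerDl.
Qed.
HB.instance Definition _ := GRing.Zmodule_isLmodule.Build k pathAlg
  pa_scaleA pa_scale1 pa_scaleDr pa_scaleDl.

Fact pa_malg_linear : linear pa_malg.
Proof.
move=> c x y; rewrite /GRing.scale /GRing.add /= [pa_scale]unlock.
by rewrite [pa_add]unlock.
Qed.
HB.instance Definition _ :=
  GRing.isLinear.Build k pathAlg {malg k[qpath Q]} *:%R pa_malg pa_malg_linear.

Lemma pa_malg_inj : injective pa_malg.
Proof. exact: val_inj. Qed.

Lemma pa_malg_basis p : pa_malg (basis_path p) = << p >>.
Proof. by rewrite [basis_path]unlock. Qed.

Lemma pa_coeff_basis p q : (pa_malg (basis_path p))@_q = (p == q)%:R.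
Proof. by rewrite pa_malg_basis mcoeffU. Qed.

Lemma pathAlgE x :
  x = \sum_(p <- msupp (pa_malg x)) (pa_malg x)@_p *: basis_path p.
Proof.
apply: pa_malg_inj; rewrite raddf_sum {1}[pa_malg x]monalgE.
apply: eq_bigr => p _; rewrite malgUZ.
by rewrite [RHS]linearZ /= pa_malg_basis.
Qed.

Definition pa_one : pathAlg := \sum_v basis_path (path_vertex v).
Definition pa_basis_mul p q : pathAlg := oapp basis_path 0 (path_cat p q).
Definition pa_mul : pathAlg -> pathAlg -> pathAlg := locked_with pa_key
  (fun x y => lext (fun p => lext (pa_basis_mul p) (pa_malg y)) (pa_malg x)).
Canonical pa_mul_unlockable := [unlockable of pa_mul].

Lemma is_walk_cat v s t :
  is_walk v (s ++ t) = is_walk v s && is_walk (last v (map (@target Q) s)) t.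
Proof. by elim: s v => //= a s IHs v; rewrite IHs andbA. Qed.

Lemma path_catE p q r : path_cat p q = Some r <->
  [/\ path_end p = path_start q, path_start r = path_start p &
      path_arrows r = path_arrows p ++ path_arrows q].
Proof.
rewrite /path_cat; split.
  case: eqP => // pq; case: insubP => // u _ Eu [<-].
  by rewrite /path_start /path_arrows Eu.
case=> pq sr ar; rewrite pq eqxx; case: insubP => [u _ Eu|].
  congr Some; apply: val_inj; rewrite Eu -sr -ar.
  by rewrite /path_start /path_arrows; case: (val r).
by rewrite -sr -ar (valP r).
Qed.

Lemma path_cat_some p q : path_end p = path_start q ->
  exists r, path_cat p q = Some r.
Proof.
move=> pq; rewrite /path_cat pq eqxx; case: insubP => [u _ _|]; first by exists u.
by rewrite /= is_walk_cat (valP p) /= -/(path_end p) pq (valP q).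
Qed.

Lemma path_cat_none p q : path_end p <> path_start q -> path_cat p q = None.
Proof. by rewrite /path_cat; case: eqP. Qed.

Lemma path_cat_end p q r : path_cat p q = Some r -> path_end r = path_end q.
Proof.
by case/path_catE => pq sr ar; rewrite /path_end sr ar map_cat last_cat -pq.
Qed.

Lemma path_catA p q r :
  obind (path_cat p) (path_cat q r) = obind (path_cat^~ r) (path_cat p q).
Proof.
have [pq|pq] := eqVneq (path_end p) (path_start q); last first.
  rewrite (path_cat_none (elimN eqP pq)) /=; case Eqr: (path_cat q r) => [s|] //=.
  by case/path_catE: Eqr => _ ss _; apply: path_cat_none; rewrite ss; apply/eqP.
have [s Es] := path_cat_some pq; rewrite Es /=.
have [qr|qr] := eqVneq (path_end q) (path_start r); last first.
  by rewrite !path_cat_none // ?(path_cat_end Es); apply/eqP.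
have [u Eu] := path_cat_some qr; rewrite Eu /=.
have [w Ew] := @path_cat_some s r (etrans (path_cat_end Es) qr).
rewrite Ew; apply/path_catE.
case/path_catE: Es => _ ss sa; case/path_catE: Eu => _ us ua.
case/path_catE: Ew => _ ws wa.
by rewrite us ws ss wa sa ua catA.
Qed.

Fact pa_mulUU p q : pa_mul (basis_path p) (basis_path q) = pa_basis_mul p q.
Proof. by rewrite [pa_mul]unlock !pa_malg_basis !lextU. Qed.

Fact pa_mul_linl y : linear (pa_mul^~ y).
Proof. by move=> c x x'; rewrite [pa_mul]unlock !linearP. Qed.

Fact pa_mul_linr x : linear (pa_mul x).
Proof.
move=> c y y'; pose F p : {linear {malg k[qpath Q]} -> pathAlg} :=
  lext (pa_basis_mul p).
have E z : pa_mul x z =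
    \sum_(p <- msupp (pa_malg x)) (pa_malg x)@_p *: F p (pa_malg z).
  by rewrite [pa_mul]unlock.
rewrite !E scaler_sumr -big_split /=.
apply: eq_bigr => p _; rewrite !linearP /= !scalerA.
by rewrite [c * _]mulrC.
Qed.

Fact pa_mulPl c x x' y : pa_mul (c *: x + x') y = c *: pa_mul x y + pa_mul x' y.
Proof. exact: pa_mul_linl. Qed.

Fact pa_mulPr c x y y' : pa_mul x (c *: y + y') = c *: pa_mul x y + pa_mul x y'.
Proof. exact: pa_mul_linr. Qed.

Lemma pa_linear_ext (V : lmodType k) (f g : {linear pathAlg -> V}) :
  (forall p, f (basis_path p) = g (basis_path p)) -> f =1 g.
Proof.
move=> fg x; rewrite [x]pathAlgE !linear_sum; apply: eq_bigr => p _.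
by rewrite !linearZZ fg.
Qed.

Lemma pa_ext (f g : pathAlg -> pathAlg) : linear f -> linear g ->
  (forall p, f (basis_path p) = g (basis_path p)) -> f =1 g.
Proof.
move=> fL gL fg.
pose F := GRing.isLinear.Build k pathAlg pathAlg *:%R f fL.
pose G := GRing.isLinear.Build k pathAlg pathAlg *:%R g gL.
pose Fl : {linear pathAlg -> pathAlg} := HB.pack f F.
pose Gl : {linear pathAlg -> pathAlg} := HB.pack g G.
exact: (@pa_linear_ext _ Fl Gl fg).
Qed.

Lemma lin0 (f : pathAlg -> pathAlg) : linear f -> f 0 = 0.
Proof.
by move=> /(_ (-1) 0 0); rewrite scaler0 addr0 scaleN1r addNr.
Qed.

Fact pa_mulA : associative pa_mul.
Proof.
move=> x y z; move: x; apply: pa_ext => [c u v|c u v|p].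
- exact: pa_mul_linl.
- by rewrite !pa_mulPl.
move: y; apply: pa_ext => [c u v|c u v|q].
- by rewrite pa_mulPl pa_mulPr.
- by rewrite pa_mulPr pa_mulPl.
move: z; apply: pa_ext => [c u v|c u v|r].
- by rewrite !pa_mulPr.
- exact: pa_mul_linr.
rewrite !pa_mulUU /pa_basis_mul; have := path_catA p q r.
case: (path_cat q r) => [s|]; case: (path_cat p q) => [u|] /=.
- by rewrite !pa_mulUU /pa_basis_mul => ->.
- by rewrite pa_mulUU /pa_basis_mul => ->; rewrite (lin0 (pa_mul_linl _)).
- by rewrite pa_mulUU /pa_basis_mul => <-; rewrite (lin0 (pa_mul_linr _)).
- by rewrite (lin0 (pa_mul_linl _)) (lin0 (pa_mul_linr _)).
Qed.

Lemma path_cat1p v q : path_cat (path_vertex v) q =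
  if v == path_start q then Some q else None.
Proof.
case: eqP => [vq|vq]; last exact: path_cat_none.
by apply/path_catE.
Qed.

Lemma path_catp1 p v : path_cat p (path_vertex v) =
  if path_end p == v then Some p else None.
Proof.
case: eqP => [vq|vq]; last exact: path_cat_none.
by apply/path_catE; split=> //; rewrite cats0.
Qed.

Fact pa_mulDl : left_distributive pa_mul +%R.
Proof.
by move=> x y z; have := pa_mul_linl z 1 x y; rewrite !scale1r.
Qed.
Fact pa_mulDr : right_distributive pa_mul +%R.
Proof.
by move=> x y z; have := pa_mul_linr x 1 y z; rewrite !scale1r.
Qed.

Fact pa_mul1r : left_id pa_one pa_mul.
Proof.
apply: pa_ext => [|c u v|p] //; first exact: pa_mul_linr.
rewrite /pa_one (big_morph (pa_mul^~ _) (fun x y => pa_mulDl x y _)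
  (lin0 (pa_mul_linl _))) (bigD1 (path_start p)) //= big1 => [|v vp].
  by rewrite pa_mulUU /pa_basis_mul path_cat1p eqxx addr0.
by rewrite pa_mulUU /pa_basis_mul path_cat1p (negbTE vp).
Qed.
Fact pa_mulr1 : right_id pa_one pa_mul.
Proof.
apply: (@pa_ext (pa_mul^~ pa_one) id) => [|c u v|p] //; first exact: pa_mul_linl.
rewrite /pa_one (big_morph (pa_mul _) (pa_mulDr _)
  (lin0 (pa_mul_linr _))) (bigD1 (path_end p)) //= big1 => [|v vp].
  by rewrite pa_mulUU /pa_basis_mul path_catp1 eqxx addr0.
by rewrite pa_mulUU /pa_basis_mul path_catp1 eq_sym (negbTE vp).
Qed.
HB.instance Definition _ := GRing.Zmodule_isPzRing.Build pathAlg
  pa_mulA pa_mul1r pa_mulr1 pa_mulDl pa_mulDr.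

Fact pa_mulZl (c : k) x y : c *: (x * y) = (c *: x) * y.
Proof.
have E : pa_mul 0 y = 0 by exact: (lin0 (pa_mul_linl y)).
by have := pa_mulPl c x 0 y; rewrite E !addr0 => /esym.
Qed.
Fact pa_mulZr (c : k) x y : c *: (x * y) = x * (c *: y).
Proof. by have := pa_mulPr c x y 0; rewrite (lin0 (pa_mul_linr x)) !addr0 => /esym. Qed.
HB.instance Definition _ := isPzAlgebra.Build k pathAlg
  pa_scaleA pa_scale1 pa_scaleDr pa_scaleDl pa_mulZl pa_mulZr.

Definition vertex_elt v : pathAlg := basis_path (path_vertex v).
Definition arrow_elt a : pathAlg := basis_path (path_arrow a).

Definition arrow_ideal : ideal pathAlg :=
  ideal_gen (fun x => exists a, x = arrow_elt a).

Definition admissible (I : ideal pathAlg) : Prop :=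
  exists m, [/\ (2 <= m)%N, forall x, ideal_exp arrow_ideal m x -> I x &
                forall x, I x -> ideal_exp arrow_ideal 2 x].

Definition minimal_generators (I : ideal pathAlg) (X : pathAlg -> Prop) : Prop :=
  (forall x, ideal_gen X x <-> I x) /\
  (forall Y : pathAlg -> Prop, (forall x, Y x -> X x) ->
     (forall x, ideal_gen Y x <-> I x) -> forall x, X x -> Y x).

Variables (t : nat) (a : 'I_t -> arrow Q).

(** x lies in the span kQ* of the paths using none of the arrows a_i *)
Definition avoids (x : pathAlg) : Prop :=
  forall p, p \in msupp (pa_malg x) -> forall i, a i \notin path_arrows p.

Definition absent_from_minimal_generators (I : ideal pathAlg) : Prop :=
  exists2 X, minimal_generators I X & forall x, X x -> avoids x.

End PathAlgebra.

(* Main.v *)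
(** By the universal property of path algebras, killing the arrows a_i gives an
    endomorphism of kQ that fixes kQ*.  The generators of I lie in kQ*, so it
    preserves I and descends to the section nu : Gamma -> Lambda.  Likewise,
    sending a_i to the generator e_i (x) f_i of P_i and every other arrow to its
    class in Gamma defines a map from kQ to the trivial extension of Gamma by
    P = (+)_i P_i; it kills I because on kQ* it is the projection to Gamma.  The
    inverse is nu on Gamma and x (x) y |-> nu x * a_i * nu y on P_i; it is
    multiplicative because f_j Gamma e_i = 0.  Under this isomorphism the ideal
    generated by a_i corresponds to the summand P_i. *)

Require Import Defs.
From HB Require Import structures.
From mathcomp Require Import all_boot all_algebra.
From mathcomp Require Import boolp functions monalg.

Set Implicit Arguments.
Unset Strict Implicit.
Unset Printing Implicit Defensive.

Import GRing.Theory.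
Local Open Scope ring_scope.

(* The universe level of each [reverse_coercion] differs from one statement to
   the next; unless it is unfolded first, conversion unfolds the bimodule
   structures around it, which takes exponential time. *)
Strategy expand [reverse_coercion].

Lemma inj_surj_bijective (T U : Type) (f : T -> U) :
  injective f -> (forall y, exists x, f x = y) -> bijective f.
Proof.
move=> f_inj /choice[g fg].
by exists g => [x|y]; [apply: f_inj|]; rewrite fg.
Qed.

(** * Algebra homomorphisms and quotients by ideals *)

Section AlgHom.
Variable k : pzRingType.

Section Comp.
Variables (A B C : pzAlgType k) (g : algHom B C) (f : algHom A B).

Fact algHom_comp_scalable : scalable (g \o f).
Proof. by move=> c x; rewrite /= !algHomZ. Qed.
Definition algHom_comp : algHom A C := @AlgHom _ _ _ (g \o f) algHom_comp_scalable.

Lemma algHom_compE x : algHom_comp x = g (f x).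
Proof. by []. Qed.
End Comp.

Section Linear.
Variables (A B : pzAlgType k) (F : algHom A B).

(** An [algHom] keeps scalability as a separate field; this alias joins it to the ring morphism
    structure, so that facts about linear maps apply. *)
Definition algHom_fun : A -> B := F.
HB.instance Definition _ := GRing.RMorphism.copy algHom_fun F.
HB.instance Definition _ :=
  GRing.isScalable.Build k A B *:%R algHom_fun (@algHomZ _ _ _ F).
Definition algHom_linear : {linear A -> B} := algHom_fun.
End Linear.

Section Quotient.
Variables (A B : pzAlgType k) (I : ideal A).

Fact aproj_scalable : scalable (aproj I).
Proof. by move=> c x; rewrite linearZ. Qed.
Definition aproj_hom : algHom A (algQuot I) := AlgHom aproj_scalable.

Lemma aproj_eq0 x : I x -> aproj I x = 0.
Proof. by move=> Ix; apply/(cls_eq0 I). Qed.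

Lemma aproj_surj (q : algQuot I) : exists x, q = aproj I x.
Proof. exact: cls_surj. Qed.

Variables (F : algHom A B) (FI : forall x, I x -> F x = 0).

Definition aq_lift_fun : algQuot I -> B := lquot_lift F.

Lemma aq_lift_funE x : aq_lift_fun (aproj I x) = F x.
Proof. exact: (@lquot_liftE _ _ I _ (algHom_linear F) FI). Qed.

Fact aq_lift_zmod : zmod_morphism aq_lift_fun.
Proof.
move=> p q; have [x ->] := aproj_surj p; have [y ->] := aproj_surj q.
by rewrite -raddfB !aq_lift_funE rmorphB.
Qed.
Fact aq_lift_monoid : monoid_morphism aq_lift_fun.
Proof.
split=> [|p q]; first by rewrite -(rmorph1 (aproj I)) aq_lift_funE rmorph1.
have [x ->] := aproj_surj p; have [y ->] := aproj_surj q.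
by rewrite -rmorphM !aq_lift_funE rmorphM.
Qed.
HB.instance Definition _ :=
  GRing.isZmodMorphism.Build (algQuot I) B aq_lift_fun aq_lift_zmod.
HB.instance Definition _ :=
  GRing.isMonoidMorphism.Build (algQuot I) B aq_lift_fun aq_lift_monoid.

Fact aq_lift_scalable : scalable aq_lift_fun.
Proof.
move=> c q; have [x ->] := aproj_surj q.
by rewrite -linearZ !aq_lift_funE algHomZ.
Qed.
Definition aq_lift : algHom (algQuot I) B := AlgHom aq_lift_scalable.

Lemma aq_liftE x : aq_lift (aproj I x) = F x.
Proof. exact: aq_lift_funE. Qed.

End Quotient.

(** The kernel of [F] is a two-sided ideal, and [ideal_gen X] lies in every ideal containing [X]. *)
Lemma algHom_ker_gen (A B : pzAlgType k) (F : algHom A B) (X : A -> Prop) :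
  (forall x, X x -> F x = 0) -> forall x, ideal_gen X x -> F x = 0.
Proof.
move=> FX x.
suff [K KE] : exists K : ideal A, forall y, K y <-> F y = 0.
  by move=> gx; apply/KE/gx => y Xy; apply/KE/FX.
have K0 : F 0 = 0 by rewrite rmorph0.
have KD y z : F y = 0 -> F z = 0 -> F (y + z) = 0.
  by rewrite rmorphD => -> ->; rewrite addr0.
have Kl y z : F z = 0 -> F (y * z) = 0 by rewrite rmorphM => ->; rewrite mulr0.
have Kr y z : F y = 0 -> F (y * z) = 0 by rewrite rmorphM => ->; rewrite mul0r.
by exists (Ideal K0 KD Kl Kr).
Qed.

End AlgHom.

(** * Idempotents and homomorphisms between the right ideals they generate *)

Section Corner.
Variables (k : fieldType) (A : pzAlgType k).
Implicit Types (e f x y : A).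

Definition leftGen e : leftPart e :=
  exist _ e (asboolT (ex_intro _ 1 (esym (mul1r e)))).
Definition rightGen e : rightPart e :=
  exist _ e (asboolT (ex_intro _ 1 (esym (mulr1 e)))).

Lemma leftPart_idem e (u : leftPart e) : e * e = e -> val u * e = val u.
Proof. by move=> ee; have /asboolP[y ->] := valP u; rewrite -mulrA ee. Qed.
Lemma rightPart_idem e (u : rightPart e) : e * e = e -> e * val u = val u.
Proof. by move=> ee; have /asboolP[y ->] := valP u; rewrite mulrA ee. Qed.

Section CornerHom.
Variables e f : A.

Fact corner_act_subproof (c : corner f e) (m : rightPart e) :
  submodule_pred (right_ideal_of f) (val c * val m).
Proof.
have /asboolP[y ->] := valP c; apply/asboolP.
by exists (y * e * val m); rewrite !mulrA.
Qed.
Definition corner_act (c : corner f e) (m : rightPart e) : rightPart f :=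
  exist _ (val c * val m) (corner_act_subproof c m).

Fact corner_act_hom c : submodule_pred (rHom_submodule _ _) (corner_act c).
Proof.
apply/asboolP; split=> [d x y|m b]; apply: val_inj => /=.
  by rewrite mulrDr pzscalerAr.
by rewrite mulrA.
Qed.
Definition corner_rHom (c : corner f e) : rHom (rightPart e) (rightPart f) :=
  exist _ (corner_act c) (corner_act_hom c).

Fact corner_rHom_linear : linear corner_rHom.
Proof.
move=> d c c'; apply: val_inj; apply: functional_extensionality_dep => m.
by apply: val_inj; rewrite /= mulrDl pzscalerAl.
Qed.

(** A homomorphism out of eA is left multiplication by its value at [e]. *)
Lemma corner_rHom_iso : e * e = e ->
  lmod_iso (corner f e) (rHom (rightPart e) (rightPart f)).
Proof.
move=> ee.
pose F := GRing.isLinear.Build k _ _ *:%R corner_rHom corner_rHom_linear.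
exists (HB.pack corner_rHom F : {linear _ -> _}).
apply: inj_surj_bijective => [c c' /(congr1 val) /= cc'|h].
  have E : val c * e = val c' * e.
    exact: (congr1 (fun h : _ -> rightPart f => val (h (rightGen e))) cc').
  have /asboolP[y cE] := valP c; have /asboolP[y' cE'] := valP c'.
  apply: val_inj; move: E.
  by rewrite cE cE' -!mulrA ee.
have /asboolP[hL hB] := valP h.
(* As e e = e, the value of [h] at the generator is fixed by right multiplication by [e], hence lies
   in fAe. *)
have hg : ract (rightGen e) e = rightGen e by apply: val_inj.
have /asboolP[y hE] := valP (val h (rightGen e)).
have cP : submodule_pred (corner_of f e) (val (val h (rightGen e))).
  apply/asboolP; exists y; rewrite -hE -[in LHS]hg hB /=.
  by [].
exists (exist _ (val (val h (rightGen e))) cP); apply: val_inj.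
apply: functional_extensionality_dep => m.
apply: val_inj => /=.
rewrite -[m in RHS](_ : ract (rightGen e) (val m) = m) ?hB //.
by apply: val_inj; apply: rightPart_idem.
Qed.

(** Turns the vanishing of a Hom space into equations between elements, which survive in every
    quotient algebra. *)
Lemma rHom_eq0 : e * e = e ->
  (forall h : rHom (rightPart e) (rightPart f), h = 0) <->
  (forall x, f * x * e = 0).
Proof.
case/corner_rHom_iso => F [G FK GK]; split=> [h0 x|fxe h].
  have cP : submodule_pred (corner_of f e) (f * x * e).
    by apply/asboolP; exists x.
  pose c : corner f e := exist _ (f * x * e) cP.
  have c0 : c = 0 by apply: (can_inj FK); rewrite raddf0; apply: h0.
  exact: (congr1 val c0).
rewrite -(GK h) -(raddf0 F); congr (F _).
by apply: val_inj => /=; have /asboolP[x ->] := valP (G h).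
Qed.
End CornerHom.

End Corner.

Section LinearFunctions.
Variables (k : pzRingType) (U V : lmodType k) (f : U -> V) (fL : linear f).

(** [bimodule_hom] is a predicate on bare functions, so the standard consequences of linearity are
    drawn from its [linear] clause. *)
Lemma lin_fun0 : f 0 = 0.
Proof.
by have := fL (-1) 0 0; rewrite scaler0 addr0 scaleN1r addNr.
Qed.
Lemma lin_funD x y : f (x + y) = f x + f y.
Proof. by have := fL 1 x y; rewrite !scale1r. Qed.
Lemma lin_funZ c x : f (c *: x) = c *: f x.
Proof. by have := fL c x 0; rewrite lin_fun0 !addr0. Qed.
Lemma lin_fun_sum (J : finType) (F : J -> U) : f (\sum_j F j) = \sum_j f (F j).
Proof. exact: (big_morph f lin_funD lin_fun0). Qed.
End LinearFunctions.

(** * Projective bimodules, direct sums and tensor products *)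

Section Bimodules.
Variables (k : fieldType) (A B : pzAlgType k).

Lemma bimodule_hom_comp (L M N : bimodType A B) (g : M -> N) (f : L -> M) :
  bimodule_hom g -> bimodule_hom f -> bimodule_hom (g \o f).
Proof.
move=> [gL gA gB] [fL fA fB]; split=> [c x y|a m|m b] /=.
- by rewrite fL gL.
- by rewrite fA gA.
- by rewrite fB gB.
Qed.

Lemma bimodule_hom_can (M N : bimodType A B) (f : M -> N) (g : N -> M) :
  bimodule_hom f -> cancel f g -> cancel g f -> bimodule_hom g.
Proof.
move=> [fL fA fB] fK gK.
by split=> [c x y|a m|m b]; apply: (can_inj fK); rewrite ?fL ?fA ?fB !gK.
Qed.

Lemma bimodule_iso_sym (M N : bimodType A B) :
  bimodule_iso M N -> bimodule_iso N M.
Proof.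
case=> f fH [g fK gK]; exists g; first exact: bimodule_hom_can fH fK gK.
by exists f.
Qed.

(** A lifting problem for [N] is moved to [M] along [f], solved there, and moved back along the
    inverse. *)
Lemma projective_iso (M N : bimodType A B) :
  bimodule_iso M N -> bimodule_projective M -> bimodule_projective N.
Proof.
case=> f fH [f' fK f'K] projM L L' g h gH g_surj hH.
have [h' h'H gh'] := projM _ _ g (h \o f) gH g_surj (bimodule_hom_comp hH fH).
have f'H := bimodule_hom_can fH fK f'K.
by exists (h' \o f') => [|p /=]; [apply: bimodule_hom_comp | rewrite gh' /= f'K].
Qed.

Section DirectSumInclusion.
Variables (t : nat) (P : 'I_t -> bimodType A B).

Definition dsum_in i (p : P i) : dsum P := dfwith (0 : dsum P) p.

Lemma dsum_in_eq i (p : P i) : dsum_in p i = p.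
Proof. exact: dfwith_in. Qed.

Lemma dsum_in_neq i j (p : P i) : i != j -> dsum_in p j = 0.
Proof. exact: dfwith_out. Qed.

Lemma dsum_in_hom i : bimodule_hom (@dsum_in i).
Proof.
split=> [c x y|a m|m b]; apply: functional_extensionality_dep => j;
  case: (eqVneq i j) => [<-|ij].
(* The operations of [dsum P] are pointwise, so each component of the right-hand side has the
   displayed form by conversion. *)
- by rewrite /= [RHS](_ : _ = c *: dsum_in x i + dsum_in y i) // !dsum_in_eq.
- rewrite [RHS](_ : _ = c *: dsum_in x j + dsum_in y j) //.
  by rewrite !dsum_in_neq // scaler0 addr0.
- by rewrite [RHS](_ : _ = lact a (dsum_in m i)) // !dsum_in_eq.
- by rewrite [RHS](_ : _ = lact a (dsum_in m j)) // !dsum_in_neq // lact0r.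
- by rewrite [RHS](_ : _ = ract (dsum_in m i) b) // !dsum_in_eq.
- by rewrite [RHS](_ : _ = ract (dsum_in m j) b) // !dsum_in_neq // ract0l.
Qed.

Lemma dsum_sumE (J : finType) (F : J -> dsum P) i : (\sum_j F j) i = \sum_j F j i.
Proof. exact: (big_morph (fun x : dsum P => x i)). Qed.

Lemma dsum_inE (x : dsum P) : x = \sum_i dsum_in (x i).
Proof.
apply: functional_extensionality_dep => j; rewrite dsum_sumE (bigD1 j) //=.
rewrite dsum_in_eq big1 ?addr0 // => i ij.
by rewrite dsum_in_neq.
Qed.

(** The sum of lifts chosen on the summands is a lift. *)
Lemma projective_dsum :
  (forall i, bimodule_projective (P i)) -> bimodule_projective (dsum P).
Proof.
move=> projP M N g h gH g_surj hH.
have ex_h' i : exists h' : P i -> M,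
    bimodule_hom h' /\ forall p, g (h' p) = h (dsum_in p).
  have [h' h'H gh'] := projP i _ _ g (h \o @dsum_in i) gH g_surj
    (bimodule_hom_comp hH (dsum_in_hom i)).
  by exists h'.
pose h' i := projT1 (cid (ex_h' i)).
have h'P i : bimodule_hom (h' i) /\ forall p, g (h' i p) = h (dsum_in p).
  exact: projT2 (cid (ex_h' i)).
have h'L i : linear (h' i) by case: (h'P i) => [[]].
have h'A i a m : h' i (lact a m) = lact a (h' i m) by case: (h'P i) => [[]].
have h'B i m b : h' i (ract m b) = ract (h' i m) b by case: (h'P i) => [[]].
have [gL _ _] := gH; have [hL _ _] := hH.
exists (fun x => \sum_i h' i (x i)).
  split=> [c x y|a x|x b].
  - rewrite scaler_sumr -big_split; apply: eq_bigr => i _; exact: h'L.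
  - rewrite (big_morph (lact a) (@lactDr _ _ _ a) (lact0r _ _)).
    by apply: eq_bigr => i _; rewrite -h'A.
  - rewrite (big_morph (ract^~ b) (fun x y => @ractDl _ _ _ x y b) (ract0l _ _)).
    by apply: eq_bigr => i _; rewrite -h'B.
move=> x; rewrite [x in RHS]dsum_inE (lin_fun_sum gL) (lin_fun_sum hL).
by apply: eq_bigr => i _; case: (h'P i).
Qed.

End DirectSumInclusion.

(** [S] is a submodule [T], and the class map modulo [T] vanishes on pure tensors; a linear map is
    determined by its values there. *)
Lemma tensor_ind (U : leftModType A) (W : rightModType B) (S : tensor U W -> Prop) :
  S 0 -> (forall x y, S x -> S y -> S (x + y)) ->
  (forall (c : k) x, S x -> S (c *: x)) ->
  (forall u w, S (tens u w)) -> forall x, S x.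
Proof.
move=> S0 SD SZ Stens x; pose T := Submodule S0 SD SZ.
apply/(cls_eq0 T); apply: (@tensor_ext _ _ _ _ _ _ (cls T) (fun=> 0)).
- exact: linearP.
- by move=> c y z; rewrite scaler0 addr0.
- by move=> u w; apply/(cls_eq0 T)/Stens.
Qed.

Section CornerTensor.
Variables (e : A) (f : B) (M : bimodType A B) (m : M).

(** As u lies in Ae and w in fB, the map u (x) w |-> u m w depends only on e m f. *)
Definition corner_tensor : tensor (leftPart e) (rightPart f) -> M :=
  tensor_lift (fun (u : leftPart e) (w : rightPart f) =>
    ract (lact (val u) m) (val w)).

Lemma corner_tensorE (u : leftPart e) (w : rightPart f) :
  corner_tensor (tens u w) = ract (lact (val u) m) (val w).
Proof.
by apply: (tensor_liftE (f := fun (u : leftPart e) (w : rightPart f) =>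
    ract (lact (val u) m) (val w))) => *;
  rewrite /= ?lactDl ?lactZl ?ractDl ?ractDr ?ractZl ?ractZr.
Qed.

Lemma corner_tensor_hom : bimodule_hom corner_tensor.
Proof.
have cL : linear corner_tensor.
  by apply: tensor_lift_linear => *;
    rewrite /= ?lactDl ?lactZl ?ractDl ?ractDr ?ractZl ?ractZr.
split=> // [a|x b].
  apply: (tensor_ext (f := corner_tensor \o tensor_lact a)
                     (g := lact a \o corner_tensor)) => [c x y|c x y|u w] /=.
  - by rewrite tensor_lact_linear cL.
  - by rewrite cL lactDr lactZr.
  - by rewrite tensor_lactE !corner_tensorE /= lactM lractA.
apply: (tensor_ext (f := fun x => corner_tensor (tensor_ract x b))
                   (g := fun x => ract (corner_tensor x) b))
  => [c {}x y|c {}x y|u w] /=.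
- by rewrite tensor_ract_linear cL.
- by rewrite cL ractDl ractZl.
- by rewrite tensor_ractE !corner_tensorE /= ractM.
Qed.

End CornerTensor.

(** The bimodule Ae (x) fB is generated by e (x) f. A preimage [m] of h(e (x) f) gives the lift u
    (x) w |-> u m w, since u h(e (x) f) w = h(ue (x) fw) = h(u (x) w). *)
Lemma projective_corner_tensor (e : A) (f : B) : e * e = e -> f * f = f ->
  bimodule_projective (tensor (leftPart e) (rightPart f)).
Proof.
move=> ee ff M N g h gH g_surj hH.
have [m gm] := g_surj (h (tens (leftGen e) (rightGen f))).
exists (@corner_tensor e f M m); first exact: corner_tensor_hom.
have cH := @corner_tensor_hom e f M m.
have [cL _ _] := cH; have [gL gA gB] := gH; have [hL hA hB] := hH.
apply: (tensor_ext (f := g \o corner_tensor m)) => // [c x y|u w] /=.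
  by rewrite cL gL.
rewrite corner_tensorE gB gA gm -hA -hB.
rewrite [lact _ _]tensor_lactE [ract _ _]tensor_ractE; congr (h (tens _ _)).
  by apply: val_inj; rewrite /= leftPart_idem.
by apply: val_inj; rewrite /= rightPart_idem.
Qed.

End Bimodules.

(** * The path algebra and its universal property *)

Section PathAlgebra.
Variables (k : fieldType) (Q : quiver).
Local Notation kQ := (pathAlg k Q).

Lemma pathAlg_ind (S : kQ -> Prop) :
  S 0 -> (forall x y, S x -> S y -> S (x + y)) ->
  (forall c x, S x -> S (c *: x)) -> (forall p, S (basis_path k p)) ->
  forall x, S x.
Proof.
move=> S0 SD SZ Sb x; rewrite [x]pathAlgE.
by elim/big_ind: _ => // p _; apply: SZ.
Qed.

Lemma vertex_elt_orth (v w : vertex Q) : vertex_elt k v * vertex_elt k w =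
  if v == w then vertex_elt k v else 0.
Proof.
rewrite /GRing.mul /= pa_mulUU /pa_basis_mul path_cat1p /path_start /=.
by case: eqP => // ->.
Qed.

Lemma vertex_elt_sum : \sum_v vertex_elt k v = 1 :> kQ.
Proof. by []. Qed.

Lemma vertex_arrow_elt (b : arrow Q) :
  vertex_elt k (source b) * arrow_elt k b = arrow_elt k b.
Proof.
by rewrite /GRing.mul /= pa_mulUU /pa_basis_mul path_cat1p /path_start /= eqxx.
Qed.

Lemma arrow_vertex_elt (b : arrow Q) :
  arrow_elt k b * vertex_elt k (target b) = arrow_elt k b.
Proof.
by rewrite /GRing.mul /= pa_mulUU /pa_basis_mul path_catp1 /path_end /= eqxx.
Qed.

(** The vertex factor keeps the formula valid for trivial paths, whose product of arrows is 1. *)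
Lemma basis_pathE (p : qpath Q) :
  basis_path k p =
  vertex_elt k (path_start p) * \prod_(b <- path_arrows p) arrow_elt k b.
Proof.
case: p => -[v s] /= w; rewrite /path_start /path_arrows /=.
elim: s v w => [|b s IHs] v w.
  by rewrite big_nil mulr1; congr basis_path; apply: val_inj.
have /andP[/eqP vb ws] := w; rewrite big_cons mulrA.
(* Moving the vertex across [b] turns it into the start of the remaining path, as the induction
   hypothesis requires. *)
have -> : vertex_elt k v * arrow_elt k b = arrow_elt k b * vertex_elt k (target b).
  by rewrite -vb vertex_arrow_elt arrow_vertex_elt.
rewrite -mulrA -(IHs _ ws) /GRing.mul /= pa_mulUU /pa_basis_mul.
by rewrite (_ : path_cat _ _ = Some (exist _ (v, b :: s) w)) //; apply/path_catE.
Qed.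

(** By [basis_pathE] every path is a product of a vertex and arrows. *)
Lemma algHom_path_ext (B : pzAlgType k) (F G : algHom kQ B) :
  (forall v, F (vertex_elt k v) = G (vertex_elt k v)) ->
  (forall b, F (arrow_elt k b) = G (arrow_elt k b)) -> F =1 G.
Proof.
move=> FGv FGa; apply: pathAlg_ind => [|x y Ex Ey|c x Ex|p].
- by rewrite !rmorph0.
- by rewrite !rmorphD Ex Ey.
- by rewrite !algHomZ Ex.
- rewrite basis_pathE !rmorphM !rmorph_prod FGv; congr (_ * _).
  by apply: eq_bigr.
Qed.

Section UniversalProperty.
Variables (B : pzAlgType k) (eps : vertex Q -> B) (phi : arrow Q -> B).
Hypotheses (eps_orth : forall v w, eps v * eps w = if v == w then eps v else 0)
           (eps1 : \sum_v eps v = 1)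
           (eps_phi : forall b, eps (source b) * phi b = phi b)
           (phi_eps : forall b, phi b * eps (target b) = phi b).

(** The value that [basis_pathE] forces on a path once vertices go to [eps] and arrows to [phi]. *)
Definition path_val (p : qpath Q) : B :=
  eps (path_start p) * \prod_(b <- path_arrows p) phi b.

Lemma path_val_end p : path_val p * eps (path_end p) = path_val p.
Proof.
rewrite /path_val /path_end; case/lastP: (path_arrows p) => [|s b].
  by rewrite big_nil mulr1 eps_orth eqxx.
by rewrite map_rcons last_rcons big_rcons /= -!mulrA phi_eps.
Qed.

(** By [path_val_end] the idempotent at the end of [p] can be inserted; its product with the
    idempotent at the start of [q] detects whether the paths compose. *)
Lemma path_val_mul p q :
  path_val p * path_val q = oapp path_val 0 (path_cat p q).
Proof.
rewrite -path_val_end -mulrA [X in _ * X]mulrA eps_orth.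
have [pq|pq] := eqVneq; last by rewrite path_cat_none ?mul0r ?mulr0 //; apply/eqP.
have [r Er] := path_cat_some pq; rewrite Er mulrA path_val_end /=.
by case/path_catE: Er => _ sr ar; rewrite /path_val sr ar big_cat mulrA.
Qed.

Definition path_lift_fun (x : kQ) : B := lext path_val (pa_malg x).

Lemma path_lift_basis p : path_lift_fun (basis_path k p) = path_val p.
Proof. by rewrite /path_lift_fun pa_malg_basis lextU. Qed.

Lemma path_lift_vertex v : path_lift_fun (vertex_elt k v) = eps v.
Proof. by rewrite path_lift_basis /path_val big_nil mulr1. Qed.

Lemma path_lift_arrow b : path_lift_fun (arrow_elt k b) = phi b.
Proof. by rewrite path_lift_basis /path_val big_seq1 eps_phi. Qed.

Fact path_lift_linear : linear path_lift_fun.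
Proof. by move=> c x y; rewrite /path_lift_fun !linearP. Qed.
HB.instance Definition _ :=
  GRing.isLinear.Build k kQ B *:%R path_lift_fun path_lift_linear.

Fact path_lift_monoid : monoid_morphism path_lift_fun.
Proof.
split=> [|x y].
  rewrite {1}/GRing.one /= /pa_one raddf_sum -eps1.
  by apply: eq_bigr => v _; apply: path_lift_vertex.
(* Both sides are bilinear, so it suffices to compare them on paths, first in [x], then in [y]. *)
move: x; apply: pathAlg_ind => [|x x' Ex Ex'|c x Ex|p].
- by rewrite mul0r raddf0 mul0r.
- by rewrite mulrDl !(lin_funD path_lift_linear) Ex Ex' mulrDl.
- by rewrite -pzscalerAl !(lin_funZ path_lift_linear) Ex pzscalerAl.
move: y; apply: pathAlg_ind => [|y y' Ey Ey'|c y Ey|q].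
- by rewrite mulr0 raddf0 mulr0.
- by rewrite mulrDr !(lin_funD path_lift_linear) Ey Ey' mulrDr.
- by rewrite -pzscalerAr !(lin_funZ path_lift_linear) Ey pzscalerAr.
rewrite !path_lift_basis path_val_mul /GRing.mul /= pa_mulUU /pa_basis_mul.
by case: (path_cat p q) => [r|] /=; rewrite ?path_lift_basis ?raddf0.
Qed.
HB.instance Definition _ :=
  GRing.isMonoidMorphism.Build kQ B path_lift_fun path_lift_monoid.

Fact path_lift_scalable : scalable path_lift_fun.
Proof. by move=> c x; rewrite linearZ. Qed.
Definition path_lift : algHom kQ B := AlgHom path_lift_scalable.

End UniversalProperty.

End PathAlgebra.

(** * The two summands of a trivial extension *)

Section TrivialExtensionMaps.
Variables (k : fieldType) (A : pzAlgType k) (P : bimodType A A).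

Definition te_inl (x : A) : trivExt P := (x, 0).
Definition te_inr (p : P) : trivExt P := (0, p).

Fact te_inl_zmod : zmod_morphism te_inl.
Proof. by move=> x y; congr pair; rewrite subr0. Qed.
Fact te_inl_monoid : monoid_morphism te_inl.
Proof.
by split=> // x y; congr pair; rewrite lact0r ract0l addr0.
Qed.
HB.instance Definition _ :=
  GRing.isZmodMorphism.Build A (trivExt P) te_inl te_inl_zmod.
HB.instance Definition _ :=
  GRing.isMonoidMorphism.Build A (trivExt P) te_inl te_inl_monoid.
Fact te_inl_scalable : scalable (te_inl : A -> (trivExt P : pzAlgType k)).
Proof. by move=> c x; congr pair; rewrite /= scaler0. Qed.
Definition te_inl_hom : algHom A (trivExt P) := AlgHom te_inl_scalable.

Lemma lact0l (M : leftModType A) (m : M) : lact 0 m = 0.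
Proof. by rewrite -(scale0r 0) lactZl scale0r. Qed.
Lemma ract0r (M : rightModType A) (m : M) : ract m 0 = 0.
Proof. by rewrite -(scale0r 0) ractZr scale0r. Qed.

(** The product of two elements of [P] is zero, so only the first component of [z] acts. *)
Lemma te_mul_inr (z : trivExt P) (p : P) : z * te_inr p = te_inr (lact z.1 p).
Proof. by congr pair; rewrite ?mulr0 //= ract0r addr0. Qed.

Lemma te_inr_mul (p : P) (z : trivExt P) : te_inr p * z = te_inr (ract p z.1).
Proof. by congr pair; rewrite ?mul0r //= lact0l add0r. Qed.

Lemma te_inrD (p q : P) : te_inr (p + q) = te_inr p + te_inr q.
Proof. by congr pair; rewrite /= addr0. Qed.

End TrivialExtensionMaps.

(** * From the trivial extension of Gamma to Lambda *)

Section CornerIdeals.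
Variables (k : fieldType) (Lambda Gamma : pzAlgType k) (nu : algHom Gamma Lambda).
Variables (t : nat) (a : 'I_t -> Lambda) (e f : 'I_t -> Gamma).
Hypotheses (ee : forall i, e i * e i = e i) (ff : forall i, f i * f i = f i).
Hypothesis fxe : forall i j x, f j * x * e i = 0.

Let P (i : 'I_t) : bimodType Gamma Gamma :=
  tensor (leftPart (e i)) (rightPart (f i)).
Let L (i : 'I_t) : bimodType Gamma Gamma :=
  idealBimod nu (ideal_principal (a i)).

Definition principal_gen i : L i :=
  exist _ (a i) (asboolT (ideal_gen_sub (erefl (a i)))).

Definition gen_act i : P i -> L i := corner_tensor (principal_gen i).

Lemma gen_act_hom i : bimodule_hom (@gen_act i).
Proof. exact: (corner_tensor_hom (e i) (f i) (principal_gen i)). Qed.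

Lemma gen_actD i (p q : P i) : gen_act (p + q) = gen_act p + gen_act q.
Proof. by have [pL _ _] := gen_act_hom i; apply: lin_funD. Qed.

Lemma gen_act0 i : gen_act (0 : P i) = 0.
Proof. by have [pL _ _] := gen_act_hom i; apply: lin_fun0. Qed.

Lemma gen_actZ i c (p : P i) : gen_act (c *: p) = c *: gen_act p.
Proof. by have [pL _ _] := gen_act_hom i; apply: lin_funZ. Qed.

Lemma gen_act_lact i x (p : P i) : gen_act (lact x p) = lact x (gen_act p).
Proof. by have [_ psil _] := gen_act_hom i; apply: psil. Qed.

Lemma gen_act_ract i (p : P i) x : gen_act (ract p x) = ract (gen_act p) x.
Proof. by have [_ _ psir] := gen_act_hom i; apply: psir. Qed.

Lemma val_gen_act i (u : leftPart (e i)) (w : rightPart (f i)) :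
  val (gen_act (tens u w : P i)) = nu (val u) * a i * nu (val w).
Proof. by rewrite /gen_act corner_tensorE. Qed.

(** On pure tensors the product contains nu(w u') with w u' in f_i Gamma e_j, which is zero by
    [fxe]. So the images of the P_i multiply to zero, as the P_i do in the trivial extension. *)
Lemma gen_act_mul0 i j (p : P i) (q : P j) : val (gen_act p) * val (gen_act q) = 0.
Proof.
move: p; apply: tensor_ind => [|p p' Ep Ep'|c p Ep|u w].
- by rewrite gen_act0 mul0r.
- by rewrite gen_actD mulrDl Ep Ep' addr0.
- by rewrite gen_actZ -pzscalerAl Ep scaler0.
move: q; apply: tensor_ind => [|q q' Eq Eq'|c q Eq|u' w'].
- by rewrite gen_act0 mulr0.
- by rewrite gen_actD mulrDr Eq Eq' addr0.
- by rewrite gen_actZ -pzscalerAr Eq scaler0.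
rewrite !val_gen_act !mulrA -[X in X * a j](mulrA _ (nu _) (nu _)) -rmorphM.
rewrite -(rightPart_idem w (ff i)) -(leftPart_idem u' (ee j)).
by rewrite !mulrA -(mulrA (f i)) fxe rmorph0 mulr0 !mul0r.
Qed.

Definition from_trivExt_fun (z : trivExt (dsum P)) : Lambda :=
  nu z.1 + \sum_i val (gen_act (z.2 i)).

Fact from_trivExt_linear : linear from_trivExt_fun.
Proof.
move=> c y z; rewrite /from_trivExt_fun rmorphD algHomZ scalerDr addrACA; congr (_ + _).
rewrite scaler_sumr -big_split; apply: eq_bigr => i _ /=.
by rewrite [X in gen_act X](_ : _ = c *: y.2 i + z.2 i) // gen_actD gen_actZ.
Qed.
HB.instance Definition _ :=
  GRing.isLinear.Build k (trivExt (dsum P)) Lambda *:%R from_trivExt_fun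
    from_trivExt_linear.

Fact from_trivExt_monoid : monoid_morphism from_trivExt_fun.
Proof.
split=> [|y z].
  rewrite /from_trivExt_fun rmorph1 big1 ?addr0 // => i _.
  by rewrite [X in gen_act X](_ : _ = 0) // gen_act0.
have mulMM : (\sum_i val (gen_act (y.2 i))) * (\sum_i val (gen_act (z.2 i))) = 0.
  rewrite big_distrlr big1 // => i _.
  by rewrite big1 // => j _; apply: gen_act_mul0.
rewrite /from_trivExt_fun rmorphM mulrDl !mulrDr -!addrA mulMM addr0; congr (_ + _).
rewrite mulr_sumr mulr_suml -big_split; apply: eq_bigr => i _ /=.
rewrite [X in gen_act X](_ : _ = lact y.1 (z.2 i) + ract (y.2 i) z.1) // gen_actD.
(* The actions on [L i] are multiplication in [Lambda] through [nu], so the mixed products agree by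
   conversion. *)
exact: (congr2 +%R (congr1 val (gen_act_lact y.1 (z.2 i)))
                   (congr1 val (gen_act_ract (y.2 i) z.1))).
Qed.
HB.instance Definition _ :=
  GRing.isMonoidMorphism.Build (trivExt (dsum P)) Lambda from_trivExt_fun
    from_trivExt_monoid.

Fact from_trivExt_scalable :
  scalable (from_trivExt_fun : (trivExt (dsum P) : pzAlgType k) -> Lambda).
Proof. by move=> c x; apply: (lin_funZ from_trivExt_linear). Qed.
Definition from_trivExt : algHom (trivExt (dsum P)) Lambda :=
  AlgHom from_trivExt_scalable.

Lemma from_trivExt_inl x : from_trivExt (te_inl _ x) = nu x.
Proof.
rewrite /= /from_trivExt_fun big1 ?addr0 // => i _.
exact: (congr1 val (gen_act0 i)).
Qed.

Lemma from_trivExt_inr i (p : P i) :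
  from_trivExt (te_inr (dsum_in p)) = val (gen_act p).
Proof.
rewrite /= /from_trivExt_fun rmorph0 add0r (bigD1 i) //= dsum_in_eq.
rewrite big1 ?addr0 // => j ji; rewrite dsum_in_neq 1?eq_sym //.
exact: (congr1 val (gen_act0 j)).
Qed.

(** * The ideals generated by the a_i, given a section of [from_trivExt] *)

Variable Phi : algHom Lambda (trivExt (dsum P)).
Hypotheses (PhiK : cancel Phi from_trivExt)
  (Phi_nu : forall x, Phi (nu x) = te_inl (dsum P) x)
  (Phi_a : forall i,
     Phi (a i) = te_inr (dsum_in (tens (leftGen (e i)) (rightGen (f i)) : P i))).

(** On pure tensors, u (e_i (x) f_i) w = u e_i (x) f_i w = u (x) w. Thus [Phi] recovers [p] from
    [gen_act p]. *)
Lemma Phi_gen_act i (p : P i) : Phi (val (gen_act p)) = te_inr (dsum_in p).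
Proof.
have [inL inl inr] := dsum_in_hom P i.
move: p; apply: tensor_ind => [|p q Ep Eq|c p Ep|u w].
- by rewrite gen_act0 rmorph0 (lin_fun0 inL).
- by rewrite gen_actD rmorphD Ep Eq (lin_funD inL) te_inrD.
- rewrite gen_actZ algHomZ Ep (lin_funZ inL).
  by congr pair; rewrite /= scaler0.
rewrite val_gen_act !rmorphM !Phi_nu Phi_a te_mul_inr te_inr_mul; congr te_inr.
rewrite -inl -inr; congr dsum_in.
rewrite [lact _ _]tensor_lactE [ract _ _]tensor_ractE; congr tens.
  by apply: val_inj; rewrite /= leftPart_idem.
by apply: val_inj; rewrite /= rightPart_idem.
Qed.

(** [Phi_nu] handles Gamma and [Phi_gen_act] the summands P_i; with [PhiK] the two maps are mutually
    inverse. *)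
Lemma from_trivExtK : cancel from_trivExt Phi.
Proof.
move=> z; rewrite /= /from_trivExt_fun rmorphD Phi_nu rmorph_sum.
rewrite (eq_bigr (fun i => te_inr (dsum_in (z.2 i)))) => [|i _];
  last exact: Phi_gen_act.
rewrite -(big_morph (@te_inr _ _ _) (@te_inrD _ _ _) (erefl (te_inr 0))) -dsum_inE.
by case: z => x p; congr pair; rewrite ?addr0 ?add0r.
Qed.

(** The elements of [Lambda] that [Phi] sends into the [i]-th summand form an ideal, because by
    [te_mul_inr] and [te_inr_mul] products with that summand use only the Gamma-action; this ideal
    contains [a i]. [PhiK] brings the conclusion back to [Lambda]. *)
Lemma principal_gen_act i x :
  ideal_principal (a i) x -> exists p : P i, x = val (gen_act p).
Proof.
have [inL inl inr] := dsum_in_hom P i.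
pose S x := exists p : P i, Phi x = te_inr (dsum_in p).
have S0 : S 0 by exists 0; rewrite rmorph0 (lin_fun0 inL).
have SD y z : S y -> S z -> S (y + z).
  by case=> p Ep [q Eq]; exists (p + q); rewrite rmorphD Ep Eq (lin_funD inL) te_inrD.
have Sl y z : S z -> S (y * z).
  case=> p Ep; exists (lact (Phi y).1 p).
  by rewrite rmorphM Ep te_mul_inr inl.
have Sr y z : S y -> S (y * z).
  case=> p Ep; exists (ract p (Phi z).1).
  by rewrite rmorphM Ep te_inr_mul inr.
move=> /(_ (Ideal S0 SD Sl Sr))[y <-|p Ep]; first by eexists; apply: Phi_a.
by exists p; rewrite -from_trivExt_inr -Ep PhiK.
Qed.

Lemma gen_act_inj i : injective (@gen_act i).
Proof.
move=> p q /(congr1 (Phi \o val)) /=; rewrite !Phi_gen_act => -[pq].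
by rewrite -(dsum_in_eq p) pq dsum_in_eq.
Qed.

Lemma gen_act_surj i (x : L i) : exists p : P i, gen_act p = x.
Proof.
have /asboolP/principal_gen_act[p xp] := valP x.
by exists p; apply: val_inj.
Qed.

Lemma principal_iso i : bimodule_iso (P i) (L i).
Proof.
exists (@gen_act i); first exact: gen_act_hom.
exact: inj_surj_bijective (@gen_act_inj i) (@gen_act_surj i).
Qed.

Let S : bimodType Gamma Gamma :=
  idealBimod nu (ideal_sum (fun i => ideal_principal (a i))).

(** Surjectivity is the definition of [ideal_sum]. For injectivity the components are lifted to the
    P_i, where the sum becomes a value of [from_trivExt], an injective map. *)
Lemma dsum_ideal_iso : exists phi : dsum L -> S,
  [/\ bimodule_hom phi, bijective phi &
      forall x : dsum L, val (phi x) = \sum_i val (x i)].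
Proof.
have phiP (x : dsum L) : submodule_pred (ideal_sum (fun i => ideal_principal (a i)))
    (\sum_i val (x i)).
  apply/asboolP; exists (fun i => val (x i)) => // i.
  by have /asboolP := valP (x i).
pose phi (x : dsum L) : S := exist _ (\sum_i val (x i)) (phiP x).
exists phi; split=> //.
  split=> [c x y|b x|x b]; apply: val_inj.
  - by rewrite /= scaler_sumr -big_split.
  - by rewrite /= mulr_sumr.
  - by rewrite /= mulr_suml.
apply: inj_surj_bijective => [x y /(congr1 val) /= xy|z].
  pose p z : dsum P := fun i => projT1 (cid (gen_act_surj (z i))).
  have pE z i : gen_act (p z i) = z i by exact: projT2 (cid (gen_act_surj (z i))).
  have p_sum z : from_trivExt (te_inr (p z)) = \sum_i val (z i).
    by rewrite /= /from_trivExt_fun rmorph0 add0r; apply: eq_bigr => i _; rewrite pE.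
  have /(congr1 snd) /= pxy : te_inr (p x) = te_inr (p y).
    by apply: (can_inj from_trivExtK); rewrite !p_sum.
  by apply: functional_extensionality_dep => i; rewrite -!pE pxy.
have /asboolP[y yL zE] := valP z.
exists (fun i => exist _ (y i) (asboolT (yL i))).
by apply: val_inj; rewrite /= zE.
Qed.

Lemma ideal_sum_projective : bimodule_projective S.
Proof.
have [phi [phiH phi_bij _]] := dsum_ideal_iso.
apply: (@projective_iso _ _ _ (dsum L)); first by exists phi.
apply: projective_dsum => i; apply: (projective_iso (principal_iso i)).
exact: projective_corner_tensor.
Qed.

End CornerIdeals.

(** * Killing the arrows a_i: the section nu and the map to the trivial extension *)

Section KillArrows.
Variables (k : fieldType) (Q : quiver) (t : nat) (a : 'I_t -> arrow Q).
Local Notation kQ := (pathAlg k Q).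

Definition kept_arrow (b : arrow Q) : kQ :=
  if [exists i, a i == b] then 0 else arrow_elt k b.

Fact vertex_kept b : vertex_elt k (source b) * kept_arrow b = kept_arrow b.
Proof. by rewrite /kept_arrow; case: ifP => _; rewrite ?mulr0 ?vertex_arrow_elt. Qed.

Fact kept_vertex b : kept_arrow b * vertex_elt k (target b) = kept_arrow b.
Proof. by rewrite /kept_arrow; case: ifP => _; rewrite ?mul0r ?arrow_vertex_elt. Qed.

Definition kill_arrows : algHom kQ kQ :=
  path_lift (@vertex_elt_orth k Q) (vertex_elt_sum k Q) kept_vertex.

Lemma kill_arrows_vertex v : kill_arrows (vertex_elt k v) = vertex_elt k v.
Proof. exact: path_lift_vertex. Qed.

Lemma kill_arrows_arrow b : kill_arrows (arrow_elt k b) = kept_arrow b.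
Proof. exact: (path_lift_arrow vertex_kept). Qed.

Lemma kill_arrows_mem i : kill_arrows (arrow_elt k (a i)) = 0.
Proof.
rewrite kill_arrows_arrow /kept_arrow (_ : [exists j, _]) //.
by apply/existsP; exists i.
Qed.

(** Each path in the support of [x] is a product of a vertex and kept arrows, all of them fixed. *)
Lemma kill_arrows_avoids x : avoids a x -> kill_arrows x = x.
Proof.
move=> ax; rewrite [x]pathAlgE rmorph_sum; apply: eq_big_seq => p px.
rewrite algHomZ; congr (_ *: _); rewrite basis_pathE rmorphM kill_arrows_vertex.
rewrite rmorph_prod; congr (_ * _); apply: eq_big_seq => b bp.
rewrite kill_arrows_arrow /kept_arrow; case: existsP => // -[i /eqP ai].
by have := ax p px i; rewrite ai bp.
Qed.

Section Quotient.
Variables (I : ideal kQ) (Ia : absent_from_minimal_generators a I).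
Let Lambda : pzAlgType k := algQuot I.
Let abar (i : 'I_t) : Lambda := aproj I (arrow_elt k (a i)).
Let K : ideal Lambda := ideal_gen (fun x => exists i, x = abar i).
Let Gamma : pzAlgType k := algQuot K.

(** Some generators of [I] all lie in kQ*, so a homomorphism that vanishes on the elements of [I] in
    kQ* vanishes on [I]. *)
Lemma algHom_absent (B : pzAlgType k) (F : algHom kQ B) :
  (forall x, I x -> avoids a x -> F x = 0) -> forall x, I x -> F x = 0.
Proof.
have [X [Xgen _] Xa] := Ia => FI x Ix.
apply: (algHom_ker_gen (X := X)); last exact/Xgen.
by move=> y Xy; apply: FI; [apply/Xgen/ideal_gen_sub | apply: Xa].
Qed.

Lemma kill_arrows_ideal x : I x -> aproj I (kill_arrows x) = 0.
Proof.
apply: (algHom_absent (F := algHom_comp (aproj_hom I) kill_arrows)) => y Iy ya.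
by rewrite algHom_compE (kill_arrows_avoids ya); apply: aproj_eq0.
Qed.

Definition kill_quot : algHom Lambda Lambda :=
  aq_lift (F := algHom_comp (aproj_hom I) kill_arrows) kill_arrows_ideal.

Fact kill_quot_ideal x : K x -> kill_quot x = 0.
Proof.
apply: algHom_ker_gen => _ [i ->].
by rewrite aq_liftE algHom_compE kill_arrows_mem rmorph0.
Qed.

Definition quot_section : algHom Gamma Lambda := aq_lift kill_quot_ideal.

Lemma quot_sectionE x :
  quot_section (aproj K (aproj I x)) = aproj I (kill_arrows x).
Proof. by rewrite !aq_liftE. Qed.

(** The removed arrows are already zero in [Gamma], so the two homomorphisms agree on vertices and
    arrows. This yields pi nu = id. *)
Lemma aproj_kill_arrows x :
  aproj K (aproj I (kill_arrows x)) = aproj K (aproj I x).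
Proof.
pose F := algHom_comp (aproj_hom K) (aproj_hom I).
apply: (algHom_path_ext (F := algHom_comp F kill_arrows) (G := F)) => [v|b].
  by rewrite algHom_compE kill_arrows_vertex.
rewrite algHom_compE kill_arrows_arrow /kept_arrow.
case: existsP => // -[i /eqP <-]; rewrite rmorph0; apply/esym/aproj_eq0.
by apply: ideal_gen_sub; exists i.
Qed.

Lemma quot_sectionK : cancel quot_section (aproj K).
Proof.
move=> q; have [y ->] := aproj_surj q; have [x ->] := aproj_surj y.
by rewrite quot_sectionE aproj_kill_arrows.
Qed.

Let piG : algHom kQ Gamma := algHom_comp (aproj_hom K) (aproj_hom I).
Let eG (i : 'I_t) : Gamma := aproj K (aproj I (vertex_elt k (source (a i)))).
Let fG (i : 'I_t) : Gamma := aproj K (aproj I (vertex_elt k (target (a i)))).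
Let P (i : 'I_t) : bimodType Gamma Gamma :=
  tensor (leftPart (eG i)) (rightPart (fG i)).
Let inl : algHom kQ (trivExt (dsum P)) := algHom_comp (te_inl_hom (dsum P)) piG.

Lemma piG_idem v : piG (vertex_elt k v) * piG (vertex_elt k v) = piG (vertex_elt k v).
Proof. by rewrite -rmorphM vertex_elt_orth eqxx. Qed.

Definition arrow_gen (i : 'I_t) : trivExt (dsum P) :=
  te_inr (dsum_in (tens (leftGen (eG i)) (rightGen (fG i)) : P i)).

(** [pick] returns some index of [b]; for b = a_i it is known to be [i] itself only once [a] is
    injective. *)
Definition te_arrow (b : arrow Q) : trivExt (dsum P) :=
  if [pick i | a i == b] is Some i then arrow_gen i else inl (arrow_elt k b).

Fact te_vertex_orth v w : inl (vertex_elt k v) * inl (vertex_elt k w) =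
  if v == w then inl (vertex_elt k v) else 0.
Proof. by rewrite -rmorphM vertex_elt_orth; case: ifP => // _; rewrite rmorph0. Qed.

Fact te_vertex_sum : \sum_v inl (vertex_elt k v) = 1.
Proof. by rewrite -rmorph_sum vertex_elt_sum rmorph1. Qed.

(** For a removed arrow this is e_i (e_i (x) f_i) = e_i (x) f_i, by idempotence; otherwise it is the
    image of the relation in kQ. *)
Fact te_vertex_arrow b : inl (vertex_elt k (source b)) * te_arrow b = te_arrow b.
Proof.
rewrite /te_arrow; case: pickP => [i /eqP <-|_]; last first.
  by rewrite -rmorphM vertex_arrow_elt.
have [_ inlE _] := dsum_in_hom P i.
rewrite te_mul_inr; congr te_inr; rewrite -inlE; congr dsum_in.
rewrite [LHS]tensor_lactE; congr tens.
by apply: val_inj; apply: piG_idem.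
Qed.

Fact te_arrow_vertex b : te_arrow b * inl (vertex_elt k (target b)) = te_arrow b.
Proof.
rewrite /te_arrow; case: pickP => [i /eqP <-|_]; last first.
  by rewrite -rmorphM arrow_vertex_elt.
have [_ _ inrE] := dsum_in_hom P i.
rewrite te_inr_mul; congr te_inr; rewrite -inrE; congr dsum_in.
rewrite [LHS]tensor_ractE; congr tens.
by apply: val_inj; apply: piG_idem.
Qed.

Definition to_trivExt : algHom kQ (trivExt (dsum P)) :=
  path_lift te_vertex_orth te_vertex_sum te_arrow_vertex.

Lemma to_trivExt_vertex v : to_trivExt (vertex_elt k v) = inl (vertex_elt k v).
Proof. exact: path_lift_vertex. Qed.

Lemma to_trivExt_arrow b : to_trivExt (arrow_elt k b) = te_arrow b.
Proof. exact: (path_lift_arrow te_vertex_arrow). Qed.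

(** Once the a_i are killed, all remaining arrows go through [inl]; and [inl] does not notice the
    killing, as the a_i are zero in [Gamma]. *)
Lemma to_trivExt_kill x : to_trivExt (kill_arrows x) = inl x.
Proof.
rewrite -[RHS](_ : inl (kill_arrows x) = _); last first.
  by rewrite !algHom_compE /= aproj_kill_arrows.
apply: (algHom_path_ext (F := algHom_comp to_trivExt kill_arrows)
                        (G := algHom_comp inl kill_arrows)) => [v|b].
  by rewrite !algHom_compE kill_arrows_vertex to_trivExt_vertex.
rewrite algHom_compE [in RHS]algHom_compE kill_arrows_arrow /kept_arrow.
case: existsP => [_|ab]; first by rewrite !rmorph0.
rewrite to_trivExt_arrow /te_arrow; case: pickP => // i ai.
by case: ab; exists i.
Qed.

(** By [algHom_absent] only elements fixed by [kill_arrows] matter, and on these the map is [inl],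
    which factors through [Lambda]. *)
Fact to_trivExt_ideal x : I x -> to_trivExt x = 0.
Proof.
apply: algHom_absent => {}x Ix xa.
rewrite -(kill_arrows_avoids xa) to_trivExt_kill !algHom_compE.
by rewrite [aproj_hom I x](aproj_eq0 Ix) !rmorph0.
Qed.

Definition quot_trivExt : algHom Lambda (trivExt (dsum P)) :=
  aq_lift to_trivExt_ideal.

Lemma quot_trivExt_section x : quot_trivExt (quot_section x) = te_inl (dsum P) x.
Proof.
have [y ->] := aproj_surj x; have [z ->] := aproj_surj y.
by rewrite quot_sectionE aq_liftE to_trivExt_kill.
Qed.

Hypothesis a_inj : injective a.

Lemma quot_trivExt_arrow i : quot_trivExt (abar i) = arrow_gen i.
Proof.
rewrite aq_liftE to_trivExt_arrow /te_arrow; case: pickP => [j /eqP /a_inj -> //|].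
by move/(_ i); rewrite eqxx.
Qed.

Section Inverse.
Hypotheses (ee : forall i, eG i * eG i = eG i) (ff : forall i, fG i * fG i = fG i)
  (fxe : forall i j x, fG j * x * eG i = 0).

(** The composite is compared with the projection of kQ onto [Lambda] on vertices and arrows. *)
Lemma quot_trivExtK : cancel quot_trivExt (from_trivExt quot_section abar ee ff fxe).
Proof.
move=> q; have [x ->] := aproj_surj q; rewrite aq_liftE.
set inv := from_trivExt _ _ _ _ _.
apply: (algHom_path_ext (F := algHom_comp inv to_trivExt) (G := aproj_hom I))
  => [v|b]; rewrite algHom_compE.
  by rewrite to_trivExt_vertex [LHS]from_trivExt_inl [LHS]quot_sectionE
    kill_arrows_vertex.
rewrite to_trivExt_arrow /te_arrow; case: pickP => [i /eqP <-|ab]; last first.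
  rewrite [LHS]from_trivExt_inl [LHS]quot_sectionE kill_arrows_arrow /kept_arrow.
  by case: existsP => // -[i]; rewrite ab.
(* A removed arrow comes back as nu(e_i) a_i nu(f_i), and nu sends the class of a vertex to its
   class in [Lambda]. *)
rewrite [LHS]from_trivExt_inr val_gen_act.
rewrite [val (leftGen _)]/= [val (rightGen _)]/=.
rewrite !quot_sectionE !kill_arrows_vertex -!rmorphM vertex_arrow_elt.
by rewrite arrow_vertex_elt.
Qed.

End Inverse.

End Quotient.
End KillArrows.

Theorem proposition4p4 (k : fieldType) (Q : quiver) (I : ideal (pathAlg k Q))
    (t : nat) (a : 'I_t -> arrow Q) :
  let Lambda : pzAlgType k := algQuot I in
  let e (i : 'I_t) : Lambda := aproj I (vertex_elt k (source (a i))) in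
  let f (i : 'I_t) : Lambda := aproj I (vertex_elt k (target (a i))) in
  let abar (i : 'I_t) : Lambda := aproj I (arrow_elt k (a i)) in
  let K : ideal Lambda := ideal_gen (fun x => exists i, x = abar i) in
  let Gamma : pzAlgType k := algQuot K in
  let eG (i : 'I_t) : Gamma := aproj K (e i) in
  let fG (i : 'I_t) : Gamma := aproj K (f i) in
  let HomG_zero := forall (i j : 'I_t)
    (h : rHom (rightPart (eG i)) (rightPart (fG j))), h = 0 in
  let P (i : 'I_t) : bimodType Gamma Gamma :=
    tensor (leftPart (eG i)) (rightPart (fG i)) in
  admissible I ->
  injective a ->
  absent_from_minimal_generators a I ->
  (forall (i j : 'I_t) (h : rHom (rightPart (e i)) (rightPart (f j))), h = 0) ->
  [/\
    (* (i) *)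
    (forall i j : 'I_t,
       lmod_iso (corner (fG j) (eG i))
                (rHom (rightPart (eG i)) (rightPart (fG j)))) /\ HomG_zero,
    (* (ii) *)
    exists nu : algHom Gamma Lambda,
      let L (i : 'I_t) : bimodType Gamma Gamma :=
        idealBimod nu (ideal_principal (abar i)) in
      let S : bimodType Gamma Gamma :=
        idealBimod nu (ideal_sum (fun i => ideal_principal (abar i))) in
      [/\ injective nu, cancel nu (aproj K) &
          forall x, avoids a x -> nu (aproj K (aproj I x)) = aproj I x] /\
      [/\ exists phi : dsum L -> S,
            [/\ bimodule_hom phi, bijective phi &
                forall x : dsum L, val (phi x) = \sum_i val (x i)],
          forall i : 'I_t, bimodule_iso (L i) (P i) &
          bimodule_projective S] &
    (* (iii) *)
    alg_iso Lambda (trivExt (dsum P)) /\ HomG_zero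
  ].
Proof.
move=> Lambda e f abar K Gamma eG fG HomG_zero P _ a_inj Ia Hom0.
have idem v : aproj I (vertex_elt k v) * aproj I (vertex_elt k v) =
    aproj I (vertex_elt k v) by rewrite -rmorphM vertex_elt_orth eqxx.
have ee i : eG i * eG i = eG i by rewrite -rmorphM idem.
have ff i : fG i * fG i = fG i by rewrite -rmorphM idem.
(* Elements of [Gamma] lift to [Lambda], so f_j Lambda e_i = 0 gives f_j Gamma e_i = 0. *)
have fxe i j (x : Gamma) : fG j * x * eG i = 0.
  have [y ->] := aproj_surj x.
  have fye : f j * y * e i = 0 by apply/rHom_eq0: y => //; exact: idem.
  by rewrite -!rmorphM fye rmorph0.
have HomG0 : HomG_zero by move=> i j; apply/rHom_eq0.
pose nu : algHom Gamma Lambda := quot_section Ia.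
pose Phi : algHom Lambda (trivExt (dsum P)) := quot_trivExt Ia.
(* The stated types express these facts through the local definitions of the theorem, to which they
   are convertible. *)
have Phi_nu x : Phi (nu x) = te_inl (dsum P) x := quot_trivExt_section Ia x.
have Phi_a i : Phi (abar i) = @arrow_gen k Q t a I i := quot_trivExt_arrow Ia a_inj i.
have PhiK : cancel Phi (from_trivExt nu abar ee ff fxe) := quot_trivExtK Ia ee ff fxe.
split.
- by split=> // i j; apply: corner_rHom_iso.
- exists nu => L S; split.
    split=> [||x ax]; first exact: can_inj (quot_sectionK Ia).
      exact: quot_sectionK.
    by rewrite [LHS]quot_sectionE kill_arrows_avoids.
  split.
  + exact: (dsum_ideal_iso PhiK Phi_nu Phi_a).
  + by move=> i; apply: bimodule_iso_sym; apply: (principal_iso PhiK Phi_nu Phi_a).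
  + exact: (ideal_sum_projective PhiK Phi_nu Phi_a).
- split=> //; exists Phi; exists (from_trivExt nu abar ee ff fxe); first exact: PhiK.
  exact: (from_trivExtK ee ff fxe Phi_nu Phi_a).
Qed.
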